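(* Let $k$ be a commutative Noetherian ring and let $V$ be a finitely generated $\mathscr{C}$-module. Then for $s\geqslant 1$, $$\mathrm{hd}_s(V)\leqslant\max\{2\,\mathrm{gd}(V)-1,\ \mathrm{td}(V)\}+s.$$
   Context: $\mathscr{C}$ is the category with objects $[n]=\{1,\dots,n\}$, $n\in\mathbb{Z}_+=\{0,1,2,\dots\}$ ($[0]=\emptyset$), and morphisms the injections (a skeleton of FI); the object $[n]$ is also written $n$. $\underline{\mathscr{C}}$ is its $k$-linearization, so $\underline{\mathscr{C}}(i,j)$ is the free $k$-module on $\mathscr{C}(i,j)$, and $\underline{\mathscr{C}}(i,i)=kS_i$. A $\mathscr{C}$-module is a covariant functor $V$ from $\mathscr{C}$ to $k$-modules, $V_i$ being its value at $[i]$. It is finitely generated if it is a quotient of a finite direct sum of modules $\underline{\mathscr{C}}(i,-)$. Torsion degree: $\mathrm{td}(V)=\sup\{i\in\mathbb{Z}_+ \mid \mathrm{Hom}_{\underline{\mathscr{C}}}(\underline{\mathscr{C}}(i,i),V)\neq 0\}$, or $-\infty$ if this set is empty, where $\underline{\mathscr{C}}(i,i)$ is regarded as a $\mathscr{C}$-module concentrated at the object $i$; equivalently it is the supremum of the $i$ for which there are $0\neq v\in V_i$ and $\alpha\in\mathscr{C}(i,i+1)$ with $\alpha\cdot v=0$. Homology: let $J=\bigoplus_{0\leqslant i<j}\underline{\mathscr{C}}(i,j)$, a two-sided ideal of $\underline{\mathscr{C}}$ (viewed as a non-unital $k$-algebra), and $\underline{\mathscr{C}}_0=\underline{\mathscr{C}}/J$.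 Then $H_0(V)=V/JV\cong\underline{\mathscr{C}}_0\otimes_{\underline{\mathscr{C}}}V$ and $H_s(V)=\mathrm{Tor}_s^{\underline{\mathscr{C}}}(\underline{\mathscr{C}}_0,V)$ (the $s$-th left derived functor of $H_0$). The $s$-th homological degree is $\mathrm{hd}_s(V)=\mathrm{td}(H_s(V))$, and the generating degree is $\mathrm{gd}(V)=\mathrm{hd}_0(V)$. *)

(* Defs.v *)
From HB Require Import structures.
From mathcomp Require Import all_boot all_order all_algebra.
From mathcomp Require Import all_classical constructive_ereal.

Set Implicit Arguments.
Unset Strict Implicit.
Unset Printing Implicit Defensive.

Import Order.TTheory GRing.Theory Num.Theory.
Local Open Scope ring_scope.

Definition is_ideal (k : comPzRingType) (I : k -> Prop) : Prop :=
  [/\ I 0, forall x y, I x -> I y -> I (x + y) & forall a x, I x -> I (a * x)].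

Definition noetherian (k : comPzRingType) : Prop :=
  forall I : k -> Prop, is_ideal I ->
  exists (n : nat) (g : 'I_n -> k),
    forall x, I x <-> exists c : 'I_n -> k, x = \sum_i c i * g i.

(* The object [n] is 'I_n, that is {0, ..., n-1} in place of {1, ..., n}. *)
Record FI (i j : nat) := FImor {
  FI_fun :> {ffun 'I_i -> 'I_j};
  FI_injectiveb : injectiveb FI_fun }.
HB.instance Definition _ i j := [isSub for @FI_fun i j].
HB.instance Definition _ i j := [Finite of FI i j by <:].

Lemma FI_inj i j (f : FI i j) : injective f.
Proof. exact/injectiveP/(valP f). Qed.

Lemma FI_id_subproof i : injectiveb [ffun x : 'I_i => x].
Proof. by apply/injectiveP => x y; rewrite !ffunE. Qed.
Definition FI_id i : FI i i := FImor (FI_id_subproof i).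

Lemma FI_comp_subproof i j l (b : FI j l) (a : FI i j) :
  injectiveb [ffun x => b (a x)].
Proof.
by apply/injectiveP => x y; rewrite !ffunE => /(@FI_inj _ _ b)/(@FI_inj _ _ a).
Qed.
Definition FI_comp i j l (b : FI j l) (a : FI i j) : FI i l :=
  FImor (FI_comp_subproof b a).

Lemma FI_compA i j l m (c : FI l m) (b : FI j l) (a : FI i j) :
  FI_comp (FI_comp c b) a = FI_comp c (FI_comp b a).
Proof. by apply/val_inj/ffunP => x; rewrite !ffunE. Qed.

Lemma FI_comp1l i j (a : FI i j) : FI_comp (FI_id j) a = a.
Proof. by apply/val_inj/ffunP => x; rewrite !ffunE. Qed.

Lemma FI_comp1r i j (a : FI i j) : FI_comp a (FI_id i) = a.
Proof. by apply/val_inj/ffunP => x; rewrite !ffunE. Qed.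

Lemma FI_leq i j (a : FI i j) : (i <= j)%N.
Proof. by have := leq_card _ (@FI_inj _ _ a); rewrite !card_ord. Qed.

Record cmod (k : comPzRingType) := CMod {
  cmod_obj :> nat -> lmodType k;
  cact : forall i j, FI i j -> {linear cmod_obj i -> cmod_obj j};
  cact1 : forall i (x : cmod_obj i), cact (FI_id i) x = x;
  cactM : forall i j l (b : FI j l) (a : FI i j) (x : cmod_obj i),
    cact (FI_comp b a) x = cact b (cact a x) }.
Arguments cact {k} c {i j} _.

Record chom (k : comPzRingType) (V W : cmod k) := CHom {
  chom_app :> forall i, {linear V i -> W i};
  chom_nat : forall i j (a : FI i j) (x : V i),
    chom_app j (cact V a x) = cact W a (chom_app i x) }.

Definition chom_surj (k : comPzRingType) (V W : cmod k) (f : chom V W) : Prop :=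
  forall i (y : W i), exists x, f i x = y.

Section Basic.
Variable k : comPzRingType.
Implicit Types V W : cmod k.

Lemma chom_id_subproof V i j (a : FI i j) (x : V i) :
  idfun (cact V a x) = cact V a (idfun x).
Proof. by []. Qed.
Definition chom_id V : chom V V := CHom (@chom_id_subproof V).

Lemma chom_comp_subproof U V W (g : chom V W) (f : chom U V) i j (a : FI i j) x :
  (g j \o f j) (cact U a x) = cact W a ((g i \o f i) x).
Proof. by rewrite /= !chom_nat. Qed.
Definition chom_comp U V W (g : chom V W) (f : chom U V) : chom U W :=
  CHom (chom_comp_subproof g f).

Definition zero_obj (_ : nat) : lmodType k := {ffun void -> k^o}.
Lemma zero_act1 i (x : zero_obj i) : idfun x = x. Proof. by []. Qed.
Lemma zero_actM i j l (b : FI j l) (a : FI i j) (x : zero_obj i) :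
  idfun x = idfun (idfun x) :> zero_obj l.
Proof. by []. Qed.
Definition czero : cmod k :=
  @CMod k zero_obj (fun _ _ _ => idfun : {linear {ffun void -> k^o} -> _})
    zero_act1 zero_actM.

Lemma czero_hom_subproof V i j (a : FI i j) (x : V i) :
  (\0 : {linear V j -> czero j}) (cact V a x)
  = cact czero a ((\0 : {linear V i -> czero i}) x).
Proof. by rewrite linear0. Qed.
Definition czero_hom V : chom V czero := CHom (@czero_hom_subproof V).

Section DirectSum.
Variables V W : cmod k.
Definition dsum_obj i : lmodType k := (V i * W i)%type.
Definition dsum_act i j (a : FI i j) (x : dsum_obj i) : dsum_obj j :=
  (cact V a x.1, cact W a x.2).
Lemma dsum_act_linear i j (a : FI i j) : linear (dsum_act a).
Proof. by move=> c x y; rewrite /dsum_act /= !linearP. Qed.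
HB.instance Definition _ i j (a : FI i j) :=
  GRing.isLinear.Build k (dsum_obj i) (dsum_obj j) _ (dsum_act a)
    (dsum_act_linear a).
Lemma dsum_act1 i (x : dsum_obj i) : dsum_act (FI_id i) x = x.
Proof. by case: x => x y; rewrite /dsum_act !cact1. Qed.
Lemma dsum_actM i j l (b : FI j l) (a : FI i j) (x : dsum_obj i) :
  dsum_act (FI_comp b a) x = dsum_act b (dsum_act a x).
Proof. by rewrite /dsum_act /= !cactM. Qed.
Definition dsum : cmod k :=
  @CMod k dsum_obj (fun i j a => dsum_act a : {linear _ -> _})
    dsum_act1 dsum_actM.
End DirectSum.

(* The module C(i,-): its value at j is the free k-module on FI i j, an
   element f of which stands for \sum_g f g * [g]. *)
Section Representable.
Variable i : nat.
Definition crep_obj j : lmodType k := {ffun FI i j -> k^o}.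
Definition crep_act j l (a : FI j l) (f : crep_obj j) : crep_obj l :=
  [ffun g => \sum_(h | FI_comp a h == g) f h].
Lemma crep_act_linear j l (a : FI j l) : linear (crep_act a).
Proof.
move=> c f g; apply/ffunP => h; rewrite !ffunE scaler_sumr -big_split /=.
by apply: eq_bigr => u _; rewrite !ffunE.
Qed.
HB.instance Definition _ j l (a : FI j l) :=
  GRing.isLinear.Build k (crep_obj j) (crep_obj l) _ (crep_act a)
    (crep_act_linear a).
Lemma crep_act1 j (f : crep_obj j) : crep_act (FI_id j) f = f.
Proof.
apply/ffunP => g; rewrite ffunE (big_pred1 g) // => h.
by rewrite /= FI_comp1l.
Qed.
Lemma crep_actM j l m (b : FI l m) (a : FI j l) (f : crep_obj j) :
  crep_act (FI_comp b a) f = crep_act b (crep_act a f).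
Proof.
apply/ffunP => g; rewrite !ffunE.
rewrite (partition_big (FI_comp a) (fun h => FI_comp b h == g)) /=.
  apply: eq_bigr => u /eqP ug; rewrite ffunE; apply: eq_bigl => h.
  rewrite FI_compA; case: (FI_comp a h =P u) => [->|_]; last by rewrite andbF.
  by rewrite ug eqxx.
by move=> h; rewrite FI_compA.
Qed.
Definition crep : cmod k :=
  @CMod k crep_obj (fun j l a => crep_act a : {linear _ -> _})
    crep_act1 crep_actM.
End Representable.

Definition fin_gen V : Prop :=
  exists (s : seq nat) (f : chom (foldr dsum czero [seq crep i | i <- s]) V),
    chom_surj f.

(* The C-module C(i,i) = k S_i concentrated at the object i: its value at j is
   free on FI i j if j = i, and is free on the empty type otherwise. *)
Section Concentrated.
Variable i : nat.
Definition conc_basis j : finType := {g : FI i j | i == j}.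
Definition conc_obj j : lmodType k := {ffun conc_basis j -> k^o}.
Definition conc_act j l (a : FI j l) (f : conc_obj j) : conc_obj l :=
  [ffun g => \sum_(h | FI_comp a (val h) == val g) f h].
Lemma conc_act_linear j l (a : FI j l) : linear (conc_act a).
Proof.
move=> c f g; apply/ffunP => h; rewrite !ffunE scaler_sumr -big_split /=.
by apply: eq_bigr => u _; rewrite !ffunE.
Qed.
HB.instance Definition _ j l (a : FI j l) :=
  GRing.isLinear.Build k (conc_obj j) (conc_obj l) _ (conc_act a)
    (conc_act_linear a).
Lemma conc_act1 j (f : conc_obj j) : conc_act (FI_id j) f = f.
Proof.
apply/ffunP => g; rewrite ffunE (big_pred1 g) // => h.
by rewrite /= FI_comp1l.
Qed.
Lemma conc_actM j l m (b : FI l m) (a : FI j l) (f : conc_obj j) :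
  conc_act (FI_comp b a) f = conc_act b (conc_act a f).
Proof.
apply/ffunP => g; rewrite !ffunE.
have Pl (h : conc_basis j) : i == l.
  rewrite eqn_leq (leq_trans (FI_leq (val h)) (FI_leq a)).
  by rewrite (eqP (valP g)) (FI_leq b).
pose p (h : conc_basis j) : conc_basis l := exist _ (FI_comp a (val h)) (Pl h).
rewrite (partition_big p (fun h => FI_comp b (val h) == val g)) /=.
  apply: eq_bigr => u /eqP ug; rewrite ffunE; apply: eq_bigl => h.
  rewrite FI_compA [p h == u](_ : _ = (FI_comp a (val h) == val u)) //.
  case: (FI_comp a (val h) =P val u) => [->|_]; last by rewrite andbF.
  by rewrite ug eqxx.
by move=> h; rewrite FI_compA.
Qed.
Definition conc : cmod k :=
  @CMod k conc_obj (fun j l a => conc_act a : {linear _ -> _})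
    conc_act1 conc_actM.
End Concentrated.

Definition chom_nonzero V W (f : chom V W) : Prop :=
  exists (i : nat) (x : V i), f i x <> 0.

(* [supremum -oo] takes the empty set to -oo, and \bar int is complete for sets
   of naturals: an unbounded one has supremum +oo. *)
Definition td V : \bar int :=
  supremum -oo%E
    [set (i%:Z)%:E | i in [set i : nat | exists f : chom (conc i) V,
                                           chom_nonzero f]]%classic.

Record subcmod V := SubCMod {
  sub_obj :> forall i, submodClosed (V i);
  sub_act : forall i j (a : FI i j) (x : V i),
    x \in sub_obj i -> cact V a x \in sub_obj j }.

End Basic.

Section SubModule.
Variables (k : comPzRingType) (M : lmodType k) (S : submodClosed M).
Record sub_lmod := SubLmod { sub_val :> M; sub_valP : sub_val \in S }.
HB.instance Definition _ := [isSub for sub_val].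
HB.instance Definition _ := [Choice of sub_lmod by <:].
HB.instance Definition _ := [SubChoice_isSubLmodule of sub_lmod by <:].
End SubModule.

(* [quot_ker] is S itself: the library's Z-module quotient needs a predicate
   registered as [zmodClosed], which [submodClosed] does not imply there. *)
Section QuotientModule.
Local Open Scope quotient_scope.
Variables (k : comPzRingType) (M : lmodType k) (S : submodClosed M).
Definition quot_ker : {pred M} := [pred x | x \in S].
Lemma quot_ker_closed : zmod_closed quot_ker.
Proof.
split=> [|x y]; rewrite !inE; first exact: rpred0.
by move=> xS yS; rewrite rpredD // -scaleN1r rpredZ.
Qed.
HB.instance Definition _ := GRing.isZmodClosed.Build M quot_ker quot_ker_closed.
Definition quot_lmod := Quotient.quot quot_ker.
HB.instance Definition _ := GRing.Zmodule.on quot_lmod.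

Definition qpi (x : M) : quot_lmod := \pi_quot_lmod x.

Lemma qpiE (x y : M) : qpi x = qpi y <-> x - y \in S.
Proof.
have -> : (x - y \in S) = (qpi x == qpi y) by rewrite -Quotient.idealrBE inE.
by split=> /eqP.
Qed.
Lemma qpi_repr (q : quot_lmod) : qpi (repr q) = q.
Proof. exact: reprK. Qed.
Lemma qpi_ind (P : quot_lmod -> Prop) : (forall x, P (qpi x)) -> forall q, P q.
Proof. by move=> H q; rewrite -(qpi_repr q). Qed.
Lemma qpi_surj (q : quot_lmod) : exists x, qpi x = q.
Proof. by exists (repr q); rewrite qpi_repr. Qed.
Lemma qpiD (x y : M) : qpi (x + y) = qpi x + qpi y.
Proof. exact: Quotient.pi_add. Qed.

Definition quot_scale (c : k) (q : quot_lmod) : quot_lmod := qpi (c *: repr q).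

Lemma qpiZ (c : k) (x : M) : qpi (c *: x) = quot_scale c (qpi x).
Proof. by apply/qpiE; rewrite -scalerBr rpredZ //; apply/qpiE; rewrite qpi_repr. Qed.

Lemma quot_scaleA a b (q : quot_lmod) :
  quot_scale a (quot_scale b q) = quot_scale (a * b) q.
Proof. by elim/qpi_ind: q => x; rewrite -!qpiZ scalerA. Qed.
Lemma quot_scale1 : left_id 1 quot_scale.
Proof. by elim/qpi_ind => x; rewrite -qpiZ scale1r. Qed.
Lemma quot_scaleDr : right_distributive quot_scale +%R.
Proof.
move=> a; elim/qpi_ind => x; elim/qpi_ind => y.
by rewrite -qpiD -!qpiZ scalerDr qpiD.
Qed.
Lemma quot_scaleDl (q : quot_lmod) : {morph quot_scale^~ q : a b / a + b}.
Proof.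
by elim/qpi_ind: q => x a b; rewrite /= -!qpiZ -qpiD scalerDl.
Qed.
HB.instance Definition _ := GRing.Zmodule_isLmodule.Build k quot_lmod
  quot_scaleA quot_scale1 quot_scaleDr quot_scaleDl.

Lemma qpi_linear : linear qpi.
Proof. by move=> c x y; rewrite qpiD qpiZ. Qed.
HB.instance Definition _ := GRing.isLinear.Build k M quot_lmod _ qpi qpi_linear.

Lemma qpi_eq0 (x : M) : qpi x = 0 <-> x \in S.
Proof. by rewrite -[0](linear0 qpi) qpiE subr0. Qed.
End QuotientModule.

Section QuotientMap.
Variables (k : comPzRingType) (M N : lmodType k).
Variables (S : submodClosed M) (T : submodClosed N) (f : {linear M -> N}).
Hypothesis fST : forall x, x \in S -> f x \in T.
Definition qmap (_ : forall x, x \in S -> f x \in T) (q : quot_lmod S) :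
    quot_lmod T :=
  qpi T (f (repr q)).
Lemma qmapE x : qmap fST (qpi S x) = qpi T (f x).
Proof. by apply/qpiE; rewrite -linearB fST // -qpiE qpi_repr. Qed.
Lemma qmap_linear : linear (qmap fST).
Proof.
move=> c q r; rewrite -[q]qpi_repr -[r]qpi_repr -linearP !qmapE -linearP.
by rewrite (linearP f).
Qed.
HB.instance Definition _ :=
  GRing.isLinear.Build k (quot_lmod S) (quot_lmod T) _ (qmap fST) qmap_linear.
End QuotientMap.

Section SubQuotient.
Variables (k : comPzRingType) (V : cmod k) (S : subcmod V).

Definition csub_obj i : lmodType k := sub_lmod (S i).
Definition csub_act i j (a : FI i j) (x : csub_obj i) : csub_obj j :=
  SubLmod (sub_act a (sub_valP x)).
Lemma csub_act_linear i j (a : FI i j) : linear (csub_act a).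
Proof. by move=> c x y; apply/val_inj; rewrite /= linearP. Qed.
HB.instance Definition _ i j (a : FI i j) :=
  GRing.isLinear.Build k (csub_obj i) (csub_obj j) _ (csub_act a)
    (csub_act_linear a).
Lemma csub_act1 i (x : csub_obj i) : csub_act (FI_id i) x = x.
Proof. by apply/val_inj; rewrite /= cact1. Qed.
Lemma csub_actM i j l (b : FI j l) (a : FI i j) (x : csub_obj i) :
  csub_act (FI_comp b a) x = csub_act b (csub_act a x).
Proof. by apply/val_inj; rewrite /= cactM. Qed.
Definition csub : cmod k :=
  @CMod k csub_obj (fun i j a => csub_act a : {linear _ -> _})
    csub_act1 csub_actM.

Lemma csub_incl_subproof i j (a : FI i j) (x : csub i) :
  val (cact csub a x) = cact V a (val x).
Proof. by []. Qed.
Definition csub_incl : chom csub V :=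
  @CHom k csub V (fun i => val : {linear _ -> _}) csub_incl_subproof.

Definition cquot_obj i : lmodType k := quot_lmod (S i).
Definition cquot_act i j (a : FI i j) : {linear cquot_obj i -> cquot_obj j} :=
  qmap (@sub_act _ _ S i j a).
Lemma cquot_act1 i (q : cquot_obj i) : cquot_act (FI_id i) q = q.
Proof. by elim/qpi_ind: q => x; rewrite /= qmapE cact1. Qed.
Lemma cquot_actM i j l (b : FI j l) (a : FI i j) (q : cquot_obj i) :
  cquot_act (FI_comp b a) q = cquot_act b (cquot_act a q).
Proof. by elim/qpi_ind: q => x; rewrite /= !qmapE cactM. Qed.
Definition cquot : cmod k := CMod cquot_act1 cquot_actM.

Lemma cquot_pi_subproof i j (a : FI i j) (x : V i) :
  qpi (S j) (cact V a x) = cact cquot a (qpi (S i) x).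
Proof. by rewrite /= qmapE. Qed.
Definition cquot_pi : chom V cquot :=
  @CHom k V cquot (fun i => qpi (S i) : {linear _ -> _}) cquot_pi_subproof.
End SubQuotient.

Section Kernel.
Variables (k : comPzRingType) (V W : cmod k) (f : chom V W).

Definition ker_pred i : {pred V i} := [pred x | f i x == 0].
Arguments ker_pred : clear implicits.
Lemma kerP i (x : V i) : reflect (f i x = 0) (x \in ker_pred i).
Proof. exact: eqP. Qed.
Lemma ker_closed i : subsemimod_closed (ker_pred i).
Proof.
split; first split=> [|x y /kerP fx /kerP fy].
- by apply/kerP; rewrite linear0.
- by apply/kerP; rewrite linearD fx fy addr0.
by move=> c x /kerP fx; apply/kerP; rewrite linearZ_LR fx scaler0.
Qed.
HB.instance Definition _ i :=
  GRing.isSubmodClosed.Build k (V i) (ker_pred i) (ker_closed i).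
Lemma ker_act i j (a : FI i j) (x : V i) :
  x \in ker_pred i -> cact V a x \in ker_pred j.
Proof. by move=> /kerP fx; apply/kerP; rewrite chom_nat fx linear0. Qed.
Definition cker : subcmod V :=
  @SubCMod k V (fun i => ker_pred i : submodClosed _) ker_act.
End Kernel.

Section Image.
Variables (k : comPzRingType) (V W : cmod k) (f : chom V W).

Definition im_pred i : {pred W i} := [pred y | `[< exists x, y = f i x >]].
Arguments im_pred : clear implicits.
Lemma imP i (y : W i) : reflect (exists x, y = f i x) (y \in im_pred i).
Proof. exact: asboolP. Qed.
Lemma im_closed i : subsemimod_closed (im_pred i).
Proof.
split; first split=> [|_ _ /imP[u ->] /imP[v ->]].
- by apply/imP; exists 0; rewrite linear0.
- by apply/imP; exists (u + v); rewrite linearD.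
by move=> c _ /imP[u ->]; apply/imP; exists (c *: u); rewrite linearZ_LR.
Qed.
HB.instance Definition _ i :=
  GRing.isSubmodClosed.Build k (W i) (im_pred i) (im_closed i).
Lemma im_act i j (a : FI i j) (y : W i) :
  y \in im_pred i -> cact W a y \in im_pred j.
Proof. by move=> /imP[x ->]; apply/imP; exists (cact V a x); rewrite chom_nat. Qed.
Definition cim : subcmod W :=
  @SubCMod k W (fun i => im_pred i : submodClosed _) im_act.
End Image.

Section Preimage.
Variables (k : comPzRingType) (V W : cmod k) (f : chom V W) (S : subcmod W).

Definition preim_pred i : {pred V i} := [pred x | f i x \in S i].
Arguments preim_pred : clear implicits.
Lemma preimP i (x : V i) : reflect (f i x \in S i) (x \in preim_pred i).
Proof. exact: idP. Qed.
Lemma preim_closed i : subsemimod_closed (preim_pred i).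
Proof.
split; first split=> [|x y /preimP fx /preimP fy].
- by apply/preimP; rewrite linear0 rpred0.
- by apply/preimP; rewrite linearD rpredD.
by move=> c x /preimP fx; apply/preimP; rewrite linearZ_LR rpredZ.
Qed.
HB.instance Definition _ i :=
  GRing.isSubmodClosed.Build k (V i) (preim_pred i) (preim_closed i).
Lemma preim_act i j (a : FI i j) (x : V i) :
  x \in preim_pred i -> cact V a x \in preim_pred j.
Proof. by move=> /preimP fx; apply/preimP; rewrite chom_nat sub_act. Qed.
Definition cpreim : subcmod V :=
  @SubCMod k V (fun i => preim_pred i : submodClosed _) preim_act.
End Preimage.

(* ker g / im f, for f : U -> V and g : V -> W with g \o f = 0. *)
Definition homology (k : comPzRingType) (U V W : cmod k)
    (f : chom U V) (g : chom V W) : cmod k :=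
  cquot (cpreim (csub_incl (cker g)) (cim f)).

Section H0.
Variable k : comPzRingType.
Implicit Types V W : cmod k.

(* (JV)_j is spanned by the a.x with x in V_i, a in C(i,j) and i < j; scalar
   coefficients are absorbed in x. *)
Section J.
Variable V : cmod k.
Definition J_gen j (t : {i : 'I_j & (FI i j * V i)%type}) : V j :=
  cact V (tagged t).1 (tagged t).2.
Definition J_pred j : {pred V j} :=
  [pred y | `[< exists s, y = \sum_(t <- s) J_gen t >]].
Arguments J_pred : clear implicits.
Lemma JP j (y : V j) :
  reflect (exists s, y = \sum_(t <- s) @J_gen j t) (y \in J_pred j).
Proof. exact: asboolP. Qed.
Lemma J_closed j : subsemimod_closed (J_pred j).
Proof.
split; first split=> [|_ _ /JP[s ->] /JP[t ->]].
- by apply/JP; exists [::]; rewrite big_nil.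
- by apply/JP; exists (s ++ t); rewrite big_cat.
move=> c _ /JP[s ->]; apply/JP.
pose cs (t : {i : 'I_j & (FI i j * V i)%type}) :=
  Tagged (fun i : 'I_j => (FI i j * V i)%type)
    ((tagged t).1, c *: (tagged t).2).
exists (map cs s); rewrite big_map scaler_sumr; apply: eq_bigr => t _.
by rewrite /J_gen /= linearZ_LR.
Qed.
HB.instance Definition _ j :=
  GRing.isSubmodClosed.Build k (V j) (J_pred j) (@J_closed j).

Lemma J_genP i j (a : FI i j) (x : V i) : (i < j)%N -> cact V a x \in J_pred j.
Proof.
move=> ij; apply/JP.
exists [:: @Tagged 'I_j (Ordinal ij) (fun i : 'I_j => (FI i j * V i)%type) (a, x)].
by rewrite big_seq1.
Qed.

Lemma J_act i j (a : FI i j) (x : V i) :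
  x \in J_pred i -> cact V a x \in J_pred j.
Proof.
move=> /JP[s ->]; rewrite linear_sum rpred_sum // => t _.
rewrite /J_gen -cactM J_genP //.
exact: leq_trans (ltn_ord _) (FI_leq a).
Qed.
Definition Jsub : subcmod V :=
  @SubCMod k V (fun i => J_pred i : submodClosed _) J_act.
End J.

Definition H0 V : cmod k := cquot (Jsub V).

Section H0Map.
Variables (V W : cmod k) (f : chom V W).
Lemma H0_map_subproof i (x : V i) : x \in Jsub V i -> f i x \in Jsub W i.
Proof.
move=> /JP[s ->]; rewrite linear_sum rpred_sum // => t _.
by rewrite /J_gen chom_nat J_genP.
Qed.
Lemma H0_map_nat i j (a : FI i j) (q : H0 V i) :
  qmap (@H0_map_subproof j) (cact (H0 V) a q) =
  cact (H0 W) a (qmap (@H0_map_subproof i) q).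
Proof. by elim/qpi_ind: q => x; rewrite /= !qmapE chom_nat. Qed.
Definition H0_map : chom (H0 V) (H0 W) :=
  @CHom k (H0 V) (H0 W)
    (fun i => qmap (@H0_map_subproof i) : {linear _ -> _}) H0_map_nat.
End H0Map.
End H0.

(* Epimorphisms of C-modules are the pointwise surjections. *)
Definition projective (k : comPzRingType) (P : cmod k) : Prop :=
  forall (V W : cmod k) (p : chom V W) (f : chom P W), chom_surj p ->
  exists g : chom P V, forall i x, p i (g i x) = f i x.

Record proj_resolution (k : comPzRingType) (V : cmod k) := ProjResolution {
  res_obj :> nat -> cmod k;
  res_d : forall n, chom (res_obj n.+1) (res_obj n);
  res_aug : chom (res_obj 0) V;
  res_proj : forall n, projective (res_obj n);
  res_surj : chom_surj res_aug;
  res_exact0 : forall i (x : res_obj 0 i),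
    res_aug i x = 0 <-> exists y, x = res_d 0 i y;
  res_exact : forall n i (x : res_obj n.+1 i),
    res_d n i x = 0 <-> exists y, x = res_d n.+1 i y }.

(* The s-th left derived functor of H0 at V, computed from a projective
   resolution P of V; independent of P up to isomorphism. *)
Definition Hs (k : comPzRingType) (V : cmod k) (P : proj_resolution V) (s : nat) :
    cmod k :=
  match s with
  | 0 => homology (H0_map (res_d P 0)) (czero_hom (H0 (P 0)))
  | t.+1 => homology (H0_map (res_d P t.+1)) (H0_map (res_d P t))
  end.

Definition hd (k : comPzRingType) (V : cmod k) (P : proj_resolution V) (s : nat) :
    \bar int := td (Hs P s).

Definition gd (k : comPzRingType) (V : cmod k) : \bar int := td (H0 V).

(* Existence of projective resolutions: every V is covered by the direct sum,
   over all v in all V_i, of copies of C(i,-). At j this is the module of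
   finitely supported functions on the pairs (h, v) with h in C(i,j). *)
Section FreeCover.
Variables (k : comPzRingType) (V : cmod k).

Definition fc_basis j : choiceType := {i : nat & (FI i j * V i)%type}.
Definition fc_tag i j (h : FI i j) (v : V i) : fc_basis j :=
  Tagged (fun i => (FI i j * V i)%type) (h, v).

Lemma fsDE j (x y : fc_basis j -> k^o) t : (x + y) t = x t + y t.
Proof. by []. Qed.
Lemma fsZE j c (x : fc_basis j -> k^o) t : (c *: x) t = c * x t.
Proof. by []. Qed.

Definition fs_pred j : {pred (fc_basis j -> k^o)} :=
  [pred x | `[< exists s : seq (fc_basis j), forall t, x t <> 0 -> t \in s >]].
Arguments fs_pred : clear implicits.
Lemma fsP j (x : fc_basis j -> k^o) :
  reflect (exists s : seq (fc_basis j), forall t, x t <> 0 -> t \in s)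
    (x \in fs_pred j).
Proof. exact: asboolP. Qed.
Lemma fs_closed j : subsemimod_closed (fs_pred j).
Proof.
split; first split=> [|x y /fsP[s Hs] /fsP[t Ht]].
- by apply/fsP; exists [::].
- apply/fsP; exists (s ++ t) => u xyu; rewrite mem_cat.
  case: (pselect (x u = 0)) => [xu|/Hs -> //].
  by apply/orP; right; apply: Ht => yu; apply: xyu; rewrite fsDE xu yu addr0.
move=> c x /fsP[s Hs]; apply/fsP; exists s => u cu; apply: Hs => xu.
by apply: cu; rewrite fsZE xu mulr0.
Qed.
HB.instance Definition _ j :=
  GRing.isSubmodClosed.Build k (fc_basis j -> k^o) (fs_pred j) (fs_closed j).

Definition fc_obj j : lmodType k := sub_lmod (fs_pred j).

Lemma fcP j (x : fc_obj j) :
  exists2 s : seq (fc_basis j), uniq s & forall t, sub_val x t <> 0 -> t \in s.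
Proof.
have /fsP[s Hs] := sub_valP x; exists (undup s); first exact: undup_uniq.
by move=> t xt; rewrite mem_undup Hs.
Qed.

Definition fc_act_fun j l (a : FI j l) (x : fc_basis j -> k^o) :
    fc_basis l -> k^o :=
  fun t => \sum_(h | FI_comp a h == (tagged t).1) x (fc_tag h (tagged t).2).

Lemma fc_act_subproof j l (a : FI j l) (x : fc_obj j) :
  fc_act_fun a (sub_val x) \in fs_pred l.
Proof.
have [s _ Hs] := fcP x.
apply/fsP; exists [seq fc_tag (FI_comp a (tagged t).1) (tagged t).2 | t <- s].
case=> i [g v] xt; apply: contrapT => gs; apply: xt.
rewrite /fc_act_fun big1 //= => h /eqP ah; apply: contrapT => /Hs hs; apply: gs.
by apply/mapP; exists (fc_tag h v) => //=; rewrite ah.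
Qed.
Definition fc_act j l (a : FI j l) (x : fc_obj j) : fc_obj l :=
  SubLmod (fc_act_subproof a x).
Lemma fc_act_linear j l (a : FI j l) : linear (fc_act a).
Proof.
move=> c x y; apply/val_inj/funext => t /=.
by rewrite fsDE fsZE /fc_act_fun mulr_sumr -big_split.
Qed.
HB.instance Definition _ j l (a : FI j l) :=
  GRing.isLinear.Build k (fc_obj j) (fc_obj l) _ (fc_act a) (fc_act_linear a).
Lemma fc_act1 j (x : fc_obj j) : fc_act (FI_id j) x = x.
Proof.
apply/val_inj/funext => -[i [g v]] /=.
by rewrite /fc_act_fun (big_pred1 g) // => h; rewrite /= FI_comp1l.
Qed.
Lemma fc_actM j l m (b : FI l m) (a : FI j l) (x : fc_obj j) :
  fc_act (FI_comp b a) x = fc_act b (fc_act a x).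
Proof.
apply/val_inj/funext => -[i [g v]] /=; rewrite /fc_act_fun /=.
rewrite (partition_big (FI_comp a) (fun h => FI_comp b h == g)) /=.
  apply: eq_bigr => u /eqP ug; apply: eq_bigl => h.
  rewrite FI_compA; case: (FI_comp a h =P u) => [->|_]; last by rewrite andbF.
  by rewrite ug eqxx.
by move=> h; rewrite FI_compA.
Qed.
Definition free_cover : cmod k :=
  @CMod k fc_obj (fun j l a => fc_act a : {linear _ -> _}) fc_act1 fc_actM.

Lemma fc_delta_subproof j (t : fc_basis j) :
  (fun u => (u == t)%:R : k^o) \in fs_pred j.
Proof.
by apply/fsP; exists [:: t] => u; rewrite inE; case: eqP.
Qed.
Definition fc_delta j (t : fc_basis j) : free_cover j :=
  SubLmod (fc_delta_subproof t).

Lemma sub_val_sum j (I : Type) (s : seq I) (F : I -> fc_obj j) u :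
  sub_val (\sum_(t <- s) F t) u = \sum_(t <- s) sub_val (F t) u.
Proof. by elim/big_rec2: _ => //= t x y _ <-. Qed.

Lemma fc_gen j (x : free_cover j) :
  exists2 s, uniq s & x = \sum_(t <- s) sub_val x t *: fc_delta t.
Proof.
have [s us Hs] := fcP x; exists s => //.
apply/val_inj/funext => u /=; rewrite sub_val_sum.
have E t : sub_val (sub_val x t *: fc_delta t) u = if t == u then sub_val x u else 0.
  rewrite /= fsZE /= eq_sym.
  by case: eqP => [->|]; rewrite ?mulr1 ?mulr0.
rewrite (eq_bigr _ (fun t _ => E t)).
case: (boolP (u \in s)) => [us'|nus].
  by rewrite (bigD1_seq u) //= eqxx big1 ?addr0 // => t /negPf ->.
rewrite big1_seq => [|t /= ts]; last first.
  by case: eqP => // tu; rewrite tu (negPf nus) in ts.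
by apply: contrapT => /Hs; rewrite (negPf nus).
Qed.

Lemma fc_tag_eq i m (p q : FI i m) (x y : V i) :
  (fc_tag p x == fc_tag q y) = (p == q) && (x == y).
Proof. by rewrite [LHS]eq_Tagged xpair_eqE. Qed.
Lemma fc_tag_neq i i' m (p : FI i' m) (q : FI i m) (x : V i') (y : V i) :
  i' != i -> (fc_tag p x == fc_tag q y) = false.
Proof. by move=> ne; apply/eqP => /(congr1 tag)/eqP; rewrite /= (negPf ne). Qed.

Lemma fc_act_delta i j l (a : FI j l) (h : FI i j) (v : V i) :
  cact free_cover a (fc_delta (fc_tag h v)) = fc_delta (fc_tag (FI_comp a h) v).
Proof.
apply/val_inj/funext => -[i' [g w]].
change (\sum_(h' | FI_comp a h' == g) ((fc_tag h' w == fc_tag h v)%:R : k^o) =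
  (fc_tag g w == fc_tag (FI_comp a h) v)%:R).
have [ii'|ne] := eqVneq i' i; last first.
  by rewrite fc_tag_neq // big1 // => h' _; rewrite fc_tag_neq.
move: g w; rewrite ii' => g w.
rewrite fc_tag_eq; have [<-|ne] := eqVneq (FI_comp a h) g.
  rewrite (bigD1 h) //= fc_tag_eq eqxx big1 ?addr0 // => h' /andP[_ /negPf ne].
  by rewrite fc_tag_eq ne.
rewrite big1 // => h' /eqP ah'; rewrite fc_tag_eq.
by case: eqP => // hh'; rewrite -ah' hh' eqxx in ne.
Qed.

Section Lift.
Variables (W : cmod k) (u : forall i, V i -> W i).
Definition lift_val j (t : fc_basis j) : W j := cact W (tagged t).1 (u (tagged t).2).
Definition lift_app j (x : free_cover j) : W j :=
  \sum_(t \in [set: fc_basis j]) sub_val x t *: lift_val t.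
Lemma lift_appE j (x : free_cover j) (s : seq (fc_basis j)) :
  uniq s -> (forall t, sub_val x t <> 0 -> t \in s) ->
  lift_app x = \sum_(t <- s) sub_val x t *: lift_val t.
Proof.
move=> us Hs; rewrite /lift_app (fsbigE s) //; last first.
  move=> t _ ts; case: (pselect (sub_val x t = 0)) => [->|/Hs].
    by rewrite scale0r.
  by rewrite (negPf ts).
by apply: eq_bigl => t; rewrite in_setT.
Qed.
Lemma lift_linear j : linear (@lift_app j).
Proof.
move=> c x y; have [s _ Hs] := fcP x; have [t _ Ht] := fcP y.
pose r := undup (s ++ t).
have Hx v : sub_val x v <> 0 -> v \in r.
  by move=> /Hs vs; rewrite mem_undup mem_cat vs.
have Hy v : sub_val y v <> 0 -> v \in r.
  by move=> /Ht vt; rewrite mem_undup mem_cat vt orbT.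
rewrite !(@lift_appE _ _ r) ?undup_uniq //.
  rewrite scaler_sumr -big_split /=; apply: eq_bigr => v _.
  by rewrite scalerA -scalerDl.
move=> v cv; case: (pselect (sub_val x v = 0)) => [xv|]; last exact: Hx.
apply: Hy => yv; apply: cv.
by rewrite /= fsDE fsZE xv yv mulr0 addr0.
Qed.
HB.instance Definition _ j :=
  GRing.isLinear.Build k (free_cover j) (W j) _ (@lift_app j) (@lift_linear j).
Lemma lift_delta j (t : fc_basis j) : lift_app (fc_delta t) = lift_val t.
Proof.
rewrite (@lift_appE _ _ [:: t]) //= ?big_seq1 ?eqxx ?scale1r //.
by move=> v; rewrite inE; case: eqP.
Qed.
Lemma lift_nat j l (a : FI j l) (x : free_cover j) :
  lift_app (cact free_cover a x) = cact W a (lift_app x).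
Proof.
have [s _ ->] := fc_gen x.
have lsum m (I : Type) (y : seq I) F :
    lift_app (\sum_(t <- y) F t) = \sum_(t <- y) lift_app (F t :> free_cover m).
  exact: linear_sum.
rewrite linear_sum !lsum linear_sum.
apply: eq_bigr => -[i [h v]] _; 
have lZ m c (y : free_cover m) : lift_app (c *: y) = c *: lift_app y.
  exact: linearZ_LR.
rewrite linearZ_LR !lZ linearZ_LR; congr (_ *: _).
by rewrite (fc_act_delta a h v) !lift_delta /lift_val /= cactM.
Qed.
Definition clift : chom free_cover W :=
  @CHom k free_cover W (fun j => @lift_app j : {linear _ -> _}) lift_nat.
End Lift.

Definition fc_unit i (v : V i) : free_cover i := fc_delta (fc_tag (FI_id i) v).

Lemma fc_ext (W : cmod k) (f g : chom free_cover W) :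
  (forall i (v : V i), f i (fc_unit v) = g i (fc_unit v)) ->
  forall i x, f i x = g i x.
Proof.
move=> fg j x; have [s _ ->] := fc_gen x; rewrite !linear_sum.
apply: eq_bigr => -[i [h v]] _; rewrite !linearZ_LR; congr (_ *: _).
have -> : fc_delta (existT _ i (h, v)) = cact free_cover h (fc_unit v).
  by rewrite fc_act_delta FI_comp1r.
by rewrite !chom_nat fg.
Qed.

Lemma clift_unit (W : cmod k) (u : forall i, V i -> W i) i (v : V i) :
  clift u i (fc_unit v) = u i v.
Proof. by rewrite [LHS]lift_delta /lift_val /= cact1. Qed.

Lemma free_cover_projective : projective free_cover.
Proof.
move=> A B p f psurj.
pose u i (v : V i) : A i := projT1 (cid (psurj i (f i (fc_unit v)))).
exists (clift u); apply: (@fc_ext _ (chom_comp p (clift u)) f) => i v /=.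
by rewrite -[lift_app u _]/(clift u i _) clift_unit /u; case: cid.
Qed.

Definition cover_map : chom free_cover V := clift (fun i v => v).
Lemma cover_map_surj : chom_surj cover_map.
Proof. by move=> i v; exists (fc_unit v); rewrite clift_unit. Qed.
End FreeCover.

Section Existence.
Variables (k : comPzRingType) (V : cmod k).

Fixpoint syzygy n : cmod k :=
  if n is m.+1 then csub (cker (cover_map (syzygy m))) else V.
Definition std_d n : chom (free_cover (syzygy n.+1)) (free_cover (syzygy n)) :=
  chom_comp (csub_incl (cker (cover_map (syzygy n)))) (cover_map (syzygy n.+1)).

Lemma std_exact0 n i (x : free_cover (syzygy n) i) :
  cover_map (syzygy n) i x = 0 <-> exists y, x = std_d n i y.
Proof.
split=> [/kerP xk|[y ->]].
  have [y yx] := @cover_map_surj k (syzygy n.+1) i (SubLmod xk).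
  exists y; change (x = sub_val (cover_map (syzygy n.+1) i y)).
  by rewrite yx.
exact/kerP/(sub_valP (cover_map (syzygy n.+1) i y)).
Qed.

Lemma std_exact n i (x : free_cover (syzygy n.+1) i) :
  std_d n i x = 0 <-> exists y, x = std_d n.+1 i y.
Proof.
rewrite -std_exact0; split=> [dx|xe]; last first.
  by change (sub_val (cover_map (syzygy n.+1) i x) = 0); rewrite xe.
by apply/val_inj; exact: dx.
Qed.

Definition std_resolution : proj_resolution V :=
  @ProjResolution k V (fun n => free_cover (syzygy n)) std_d (cover_map V)
    (fun n => @free_cover_projective k (syzygy n)) (@cover_map_surj k V)
    (@std_exact0 0) std_exact.
End Existence.

(* [td] is the least upper bound it is meant to be. *)
Lemma td_leP (k : comPzRingType) (V : cmod k) (x : \bar int) :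
  (td V <= x)%E <->
  forall i, (exists f : chom (conc k i) V, chom_nonzero f) -> ((i%:Z)%:E <= x)%E.
Proof.
pose A := [set i : nat | exists f : chom (conc k i) V, chom_nonzero f]%classic.
pose B := [set (i%:Z)%:E | i in A]%classic.
rewrite -[td V]/(supremum -oo%E B).
have Bub y : ubound B y <-> forall i, A i -> ((i%:Z)%:E <= y)%E.
  split=> [By i Ai|Hy _ [i Ai <-]]; last exact: Hy.
  by apply: By; exists i.
have [B0|/set0P[b0 Bb0]] := eqVneq B classical_sets.set0.
  rewrite B0 supremum0; split=> _; last exact: leNye.
  by apply/Bub; rewrite B0 => ? [].
have [m [mub mlub]] : (supremums B !=set0)%classic.
  have [[n An]|/forallNP nA] := pselect (exists n, forall i, A i -> (i <= n)%N).
    have exA : exists i, `[< A i >] by case: Bb0 => i Ai _; exists i; apply/asboolP.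
    have ubA i : `[< A i >] -> (i <= n)%N by move=> /asboolP/An.
    have [m /asboolP Am mmax] := ex_maxnP exA ubA.
    exists (m%:Z)%:E; split; last by move=> y /Bub; exact.
    by apply/Bub => i Ai; rewrite lee_fin lez_nat mmax //; apply/asboolP.
  exists +oo%E; split; first by apply/Bub => i _; exact: leey.
  case=> [r| |] // /Bub Hy.
    have /existsNP[i /not_implyP[Ai /negP]] := nA `|r|%N.
    rewrite -ltnNge => ri; have := Hy i Ai; rewrite lee_fin => ir; exfalso.
    have := le_trans ir (ler_norm r); rewrite -abszE lez_nat leqNgt.
    by rewrite ri.
  by case: Bb0 => i Ai _; have := Hy i Ai.
rewrite /supremum ifF; last by apply/eqP => B0; rewrite B0 in Bb0.
case: xgetP => [y _ [yub ylub]|/(_ m)[]]; last by split.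
split=> [yx|/Bub Hx]; last exact: ylub.
by apply/Bub => z Bz; apply: le_trans (yub z Bz) yx.
Qed.

(* Main.v *)
(* Let S be the shift V -> V_{+1}, D the cokernel of the natural map V -> SV and
   K its kernel. One has H_0(DV)_n = H_0(V)_{n+1} and D preserves projectives,
   so H_p(V)_{n+1} = H_p(DV)_n whenever V is torsion-free, that is KV = 0. If
   V_n = 0 for n >= e, this shifting, applied to the first syzygy of V, gives
   H_p(V)_n = 0 for n >= e + p.
   Let V be torsion-free and generated in degrees <= d. Then T = K(DV) is the
   whole torsion of DV: an element whose image in a larger set comes from the
   complement of the added point does not depend on the name of that point. So
   DV/T is torsion-free, generated in degrees <= d - 1, and by induction on d the
   sequence H_1(DV/T) -> H_0(T) = T -> H_0(DV) bounds the degree of T by 2d - 2;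
   hence H_p(V)_n = 0 for n > 2d - 1 + p, p >= 1.
   For general V, split off its torsion submodule, which lives in degrees
   <= td(V). *)
Require Import Defs.
From HB Require Import structures.
From mathcomp Require Import all_boot all_order all_algebra.
From mathcomp Require Import all_classical constructive_ereal.
From mathcomp Require Import zify.

Import Order.TTheory GRing.Theory Num.Theory.
Local Open Scope ring_scope.

Set Implicit Arguments.
Unset Strict Implicit.
Unset Printing Implicit Defensive.

(** * Injections *)

Lemma FI_ext_eq i j (a b : FI i j) : a =1 b -> a = b.
Proof. by move=> ab; apply/val_inj/ffunP. Qed.

Lemma FI_compE i j l (b : FI j l) (a : FI i j) x : FI_comp b a x = b (a x).
Proof. by rewrite ffunE. Qed.

Lemma FI_comp_injl i j l (c : FI j l) (a b : FI i j) :
  FI_comp c a = FI_comp c b -> a = b.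
Proof.
move=> ab; apply: FI_ext_eq => x; apply: (@FI_inj _ _ c).
by rewrite -!FI_compE ab.
Qed.

Lemma FI_linv i j (a : FI i j) : (j <= i)%N ->
  exists b : FI j i, FI_comp b a = FI_id i.
Proof.
move=> ji; have ij : i = j by apply/eqP; rewrite eqn_leq (FI_leq a) ji.
case: j / ij a ji => a _.
have ib : injectiveb [ffun x => invF (@FI_inj _ _ a) x].
  by apply/injectiveP => x y; rewrite !ffunE; apply: (can_inj (f_invF _)).
exists (FImor ib); apply: FI_ext_eq => x.
by rewrite FI_compE !ffunE /= (invF_f (@FI_inj _ _ a)).
Qed.

Lemma FI_lift_subproof j (y : 'I_j) : injectiveb [ffun z : 'I_j.-1 => lift y z].
Proof. by apply/injectiveP => u v; rewrite !ffunE => /lift_inj. Qed.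
Definition FI_lift j (y : 'I_j) : FI j.-1 j := FImor (FI_lift_subproof y).
Lemma FI_liftE j (y : 'I_j) z : FI_lift y z = lift y z.
Proof. by rewrite ffunE. Qed.

Lemma FI_split i j (x : 'I_i) (a b : FI i j) :
  a x = b x -> FI_comp a (FI_lift x) = FI_comp b (FI_lift x) -> a = b.
Proof.
move=> abx ab; apply: FI_ext_eq => z; case: (unliftP x z) => [u ->|-> //].
by rewrite -!FI_liftE -!FI_compE ab.
Qed.

Section Avoid.
Variables (i j : nat) (a : FI i j) (y : 'I_j) (ay : forall x, y != a x).
Lemma FI_avoid_subproof : injectiveb [ffun x => s2val (unlift_some (ay x))].
Proof.
apply/injectiveP => u v; rewrite !ffunE.
case: unlift_some => /= u' au _; case: unlift_some => /= v' av _ uv.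
by apply: (@FI_inj _ _ a); rewrite au av uv.
Qed.
Definition FI_avoid : FI i j.-1 := FImor FI_avoid_subproof.
Lemma FI_avoidK : FI_comp (FI_lift y) FI_avoid = a.
Proof.
apply: FI_ext_eq => x; rewrite FI_compE FI_liftE ffunE.
by case: unlift_some.
Qed.
End Avoid.

Lemma FI_del_subproof i j (a : FI i j) (x : 'I_i) z :
  a x != FI_comp a (FI_lift x) z.
Proof. by rewrite FI_compE FI_liftE (inj_eq (@FI_inj _ _ a)) neq_lift. Qed.
(** The restriction of [a] to the complements of [x] and [a x], each renumbered through [lift]. *)
Definition FI_del i j (a : FI i j) (x : 'I_i) : FI i.-1 j.-1 :=
  FI_avoid (FI_del_subproof a x).
Lemma FI_delK i j (a : FI i j) x :
  FI_comp (FI_lift (a x)) (FI_del a x) = FI_comp a (FI_lift x).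
Proof. exact: FI_avoidK. Qed.

Lemma FI_del_id i (x : 'I_i) : FI_del (FI_id i) x = FI_id i.-1.
Proof.
apply: (@FI_comp_injl _ _ _ (FI_lift (FI_id i x))).
by rewrite FI_delK FI_comp1l FI_comp1r ffunE.
Qed.

Lemma FI_del_comp i j l (b : FI j l) (a : FI i j) x :
  FI_del (FI_comp b a) x = FI_comp (FI_del b (a x)) (FI_del a x).
Proof.
apply: (@FI_comp_injl _ _ _ (FI_lift (FI_comp b a x))).
by rewrite FI_delK FI_compE -FI_compA FI_delK !FI_compA FI_delK.
Qed.

Lemma FI_cons_subproof i j (x : 'I_i) (y : 'I_j) (a : FI i.-1 j.-1) :
  injectiveb [ffun z => if unlift x z is Some u then lift y (a u) else y].
Proof.
apply/injectiveP => u v; rewrite !ffunE.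
case: (unliftP x u) => [u' ->|->]; case: (unliftP x v) => [v' ->|->] //.
- by move=> /lift_inj/(@FI_inj _ _ a) ->.
- by move=> /eqP; rewrite eq_sym (negPf (neq_lift _ _)).
- by move=> /eqP; rewrite (negPf (neq_lift _ _)).
Qed.
Definition FI_cons i j (x : 'I_i) (y : 'I_j) (a : FI i.-1 j.-1) : FI i j :=
  FImor (FI_cons_subproof x y a).
Lemma FI_consE i j (x : 'I_i) (y : 'I_j) a : FI_cons x y a x = y.
Proof. by rewrite ffunE unlift_none. Qed.
Lemma FI_consK i j (x : 'I_i) (y : 'I_j) a :
  FI_comp (FI_cons x y a) (FI_lift x) = FI_comp (FI_lift y) a.
Proof.
by apply: FI_ext_eq => z; rewrite !FI_compE !FI_liftE ffunE liftK.
Qed.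

Definition FI_ext i j (a : FI i j) : FI i.+1 j.+1 :=
  @FI_cons i.+1 j.+1 ord0 ord0 a.
Definition FI_shift n : FI n n.+1 := @FI_lift n.+1 ord0.
(** A bijection moving [x] to [ord0] and keeping the order of the other points. Its codomain
    [n.-1.+1] is [n], since the point [x] forces [n] to be positive. *)
Definition FI_front n (x : 'I_n) : FI n n.-1.+1 :=
  @FI_cons n n.-1.+1 x ord0 (FI_id n.-1).

Lemma FI_ext_shift i j (a : FI i j) :
  FI_comp (FI_ext a) (FI_shift i) = FI_comp (FI_shift j) a.
Proof. exact: (@FI_consK i.+1 j.+1 ord0 ord0 a). Qed.

Lemma FI_ext_id i : FI_ext (FI_id i) = FI_id i.+1.
Proof.
apply: (@FI_split _ _ ord0); first by rewrite FI_consE ffunE.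
by rewrite FI_consK FI_comp1l FI_comp1r.
Qed.

Lemma FI_ext_comp i j l (b : FI j l) (a : FI i j) :
  FI_ext (FI_comp b a) = FI_comp (FI_ext b) (FI_ext a).
Proof.
apply: (@FI_split _ _ ord0); first by rewrite FI_compE !FI_consE.
by rewrite FI_compA !FI_consK -!FI_compA FI_consK.
Qed.

Lemma FI_front0 n : FI_front (@ord0 n) = FI_id n.+1.
Proof. exact: FI_ext_id. Qed.

Lemma FI_front_lift n (x : 'I_n) : FI_comp (FI_front x) (FI_lift x) = FI_shift n.-1.
Proof. by rewrite FI_consK FI_comp1r. Qed.

Lemma FI_front_linv n (x : 'I_n) : exists b, FI_comp b (FI_front x) = FI_id n.
Proof. by apply: FI_linv; case: n x => [[]|]. Qed.

Lemma FI_front_comp i j (a : FI i j) x :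
  FI_comp (FI_front (a x)) a = FI_comp (FI_ext (FI_del a x)) (FI_front x).
Proof.
apply: (@FI_split _ _ x); first by rewrite !FI_compE !FI_consE.
rewrite !FI_compA -FI_delK FI_front_lift FI_ext_shift -FI_compA.
by rewrite FI_front_lift.
Qed.

Lemma FI_del_ext i j (a : FI i j) : FI_del (FI_ext a) ord0 = a.
Proof.
apply: (@FI_comp_injl _ _ _ (FI_lift (FI_ext a ord0))).
by rewrite FI_delK FI_consK FI_consE.
Qed.

Lemma FI_missing i j (a : FI i j) : (i < j)%N -> exists y, forall x, y != a x.
Proof.
move=> ij; have [y ny] : exists y, y \notin codom a.
  apply/existsP; rewrite -negb_forall; apply/negP => /forallP ca.
  have : #|codom a| = #|'I_j| by apply: eq_card => y; rewrite ca.
  by rewrite card_codom ?card_ord; [move=> E; rewrite E ltnn in ij|exact: FI_inj].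
by exists y => x; apply: contraNneq ny => ->; apply: codom_f.
Qed.

(** Once [y] is renamed [ord0], a map avoiding it factors through the standard inclusion. This
    reduces statements about all injections to [FI_shift]. *)
Lemma FI_factor i j (a : FI i j) y : (forall x, y != a x) ->
  exists c : FI i j.-1, FI_comp (FI_front y) a = FI_comp (FI_shift _) c.
Proof.
move=> ay; exists (FI_avoid ay).
by rewrite -[in LHS](FI_avoidK ay) -FI_compA FI_front_lift.
Qed.

(** * Vanishing of homology by dimension shifting *)

Section Morphisms.
Variable k : comPzRingType.
Implicit Types U V W X : cmod k.

Definition linear_of (M N : lmodType k) (f : M -> N) (fl : linear f) :
    {linear M -> N} :=
  HB.pack f (GRing.isLinear.Build k M N _ f fl).

Definition chom_of V W (f : forall i, V i -> W i) (fl : forall i, linear (f i))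
    (fn : forall i j (a : FI i j) x, f j (cact V a x) = cact W a (f i x)) :
    chom V W :=
  @CHom k V W (fun i => linear_of (fl i)) fn.

Lemma chom_0 V W (f : chom V W) i : f i 0 = 0.
Proof. exact: linear0. Qed.
Lemma chom_D V W (f : chom V W) i x y : f i (x + y) = f i x + f i y.
Proof. exact: linearD. Qed.
Lemma chom_N V W (f : chom V W) i x : f i (- x) = - f i x.
Proof. exact: linearN. Qed.
Lemma chom_B V W (f : chom V W) i x y : f i (x - y) = f i x - f i y.
Proof. exact: linearB. Qed.

Section Corestrict.
Variables (V W : cmod k) (S : subcmod W) (f : chom V W).
Hypothesis fS : forall i x, f i x \in S i.
Lemma corestrict_linear i : linear (fun x => SubLmod (fS (i := i) x) : csub S i).
Proof. by move=> c x y; apply: val_inj; rewrite /= linearP. Qed.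
Lemma corestrict_nat i j (a : FI i j) x :
  SubLmod (fS (cact V a x)) = cact (csub S) a (SubLmod (fS x)).
Proof. by apply: val_inj; rewrite /= chom_nat. Qed.
Definition corestrict : chom V (csub S) := chom_of corestrict_linear corestrict_nat.
Lemma corestrictE i x : sub_val (corestrict i x) = f i x.
Proof. by []. Qed.
End Corestrict.

Section Restrict.
Variables (V W : cmod k) (S : subcmod V) (T : subcmod W) (f : chom V W).
Hypothesis fST : forall i x, x \in S i -> f i x \in T i.
Lemma restrict_subproof i (x : csub S i) :
  chom_comp f (csub_incl S) i x \in T i.
Proof. exact/fST/sub_valP. Qed.
Definition restrict : chom (csub S) (csub T) := corestrict restrict_subproof.
End Restrict.

Lemma comb_linear V W (f g : chom V W) i : linear (fun x => f i x - g i x).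
Proof.
by move=> c x y; rewrite (linearP (f i)) (linearP (g i)) opprD scalerBr addrACA.
Qed.
Lemma comb_nat V W (f g : chom V W) i j (a : FI i j) x :
  f j (cact V a x) - g j (cact V a x) = cact W a (f i x - g i x).
Proof. by rewrite !chom_nat linearB. Qed.
Definition chom_sub V W (f g : chom V W) : chom V W :=
  chom_of (comb_linear f g) (comb_nat f g).

Lemma inl_linear V W i : linear (fun x : V i => (x, 0) : dsum V W i).
Proof.
by move=> c x y; congr pair; rewrite [RHS]/= scaler0 addr0.
Qed.
Lemma inl_nat V W i j (a : FI i j) x :
  ((cact V a x, 0) : dsum V W j) = cact (dsum V W) a ((x, 0) : dsum V W i).
Proof. by rewrite /= /dsum_act /= linear0. Qed.
Definition dsum_inl V W : chom V (dsum V W) := chom_of (@inl_linear V W) (@inl_nat V W).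

Lemma inr_linear V W i : linear (fun x : W i => (0, x) : dsum V W i).
Proof.
by move=> c x y; congr pair; rewrite [RHS]/= scaler0 addr0.
Qed.
Lemma inr_nat V W i j (a : FI i j) x :
  ((0, cact W a x) : dsum V W j) = cact (dsum V W) a ((0, x) : dsum V W i).
Proof. by rewrite /= /dsum_act /= linear0. Qed.
Definition dsum_inr V W : chom W (dsum V W) := chom_of (@inr_linear V W) (@inr_nat V W).

Lemma fst_linear V W i : linear (fun x : dsum V W i => x.1).
Proof. by []. Qed.
Lemma fst_nat V W i j (a : FI i j) (x : dsum V W i) :
  (cact (dsum V W) a x).1 = cact V a x.1.
Proof. by []. Qed.
Definition dsum_fst V W : chom (dsum V W) V := chom_of (@fst_linear V W) (@fst_nat V W).

Lemma snd_linear V W i : linear (fun x : dsum V W i => x.2).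
Proof. by []. Qed.
Lemma snd_nat V W i j (a : FI i j) (x : dsum V W i) :
  (cact (dsum V W) a x).2 = cact W a x.2.
Proof. by []. Qed.
Definition dsum_snd V W : chom (dsum V W) W := chom_of (@snd_linear V W) (@snd_nat V W).

Section Copair.
Variables (U V W : cmod k) (f : chom U W) (g : chom V W).
Lemma copair_linear i : linear (fun x : dsum U V i => f i x.1 + g i x.2).
Proof. by move=> c x y; rewrite /= !linearP scalerDr addrACA. Qed.
Lemma copair_nat i j (a : FI i j) (x : dsum U V i) :
  f j (cact (dsum U V) a x).1 + g j (cact (dsum U V) a x).2
  = cact W a (f i x.1 + g i x.2).
Proof. by rewrite /= !chom_nat linearD. Qed.
Definition copair : chom (dsum U V) W := chom_of copair_linear copair_nat.
Lemma copairE i x y : copair i (x, y) = f i x + g i y.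
Proof. by []. Qed.
End Copair.

Lemma dsum_projective V W : projective V -> projective W -> projective (dsum V W).
Proof.
move=> pV pW A B p f psurj.
have [g gE] := pV _ _ p (chom_comp f (dsum_inl V W)) psurj.
have [h hE] := pW _ _ p (chom_comp f (dsum_inr V W)) psurj.
exists (copair g h) => i [x y].
rewrite copairE linearD gE hE /= -linearD.
by congr (f i _); congr pair; rewrite /= ?addr0 ?add0r.
Qed.

Lemma Jsub_ind V n (Q : V n -> Prop) :
  Q 0 -> (forall x y, Q x -> Q y -> Q (x + y)) ->
  (forall i (a : FI i n) x, (i < n)%N -> Q (cact V a x)) ->
  forall x, x \in Jsub V n -> Q x.
Proof.
move=> Q0 QD Qa x /JP[s ->]; elim/big_ind: _ => // t _.
exact/Qa/ltn_ord.
Qed.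

Lemma Jsub_map V W (f : chom V W) n x : x \in Jsub V n -> f n x \in Jsub W n.
Proof. exact: H0_map_subproof. Qed.

Lemma Jsub_lift V W (f : chom V W) n y : chom_surj f -> y \in Jsub W n ->
  exists2 x, x \in Jsub V n & f n x = y.
Proof.
move=> fs yJ; move: y yJ; apply: Jsub_ind => [|_ _ [x xJ <-] [y' yJ <-]|i a z ni].
- by exists 0; rewrite ?rpred0 ?chom_0.
- by exists (x + y'); rewrite ?rpredD ?chom_D.
have [x <-] := fs i z; exists (cact V a x); last by rewrite chom_nat.
exact: J_genP.
Qed.
Lemma ker_valP V W (f : chom V W) i (x : csub (cker f) i) : f i (sub_val x) = 0.
Proof. exact/kerP/(sub_valP x). Qed.

(* The kernel of H_0(ker f) -> H_0(F) vanishes in degree n; for a projective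
   cover f this kernel is H_1(V). *)
Definition H1_zero F V (f : chom F V) n : Prop :=
  forall x : csub (cker f) n,
    sub_val x \in Jsub F n -> x \in Jsub (csub (cker f)) n.

(** Each step picks some projective module onto the next kernel; [cover_zero_retract] makes the
    choice immaterial. *)
Fixpoint cover_zero q F V (f : chom F V) n : Prop :=
  match q with
  | 0 => H1_zero f n
  | r.+1 => exists G (g : chom G (csub (cker f))),
      [/\ projective G, chom_surj g & cover_zero r g n]
  end.

(* The statement H_p(V)_n = 0, computed by dimension shifting. *)
Definition Hzero p V n : Prop :=
  match p with
  | 0 => forall x, x \in Jsub V n
  | q.+1 => exists F (f : chom F V),
      [/\ projective F, chom_surj f & cover_zero q f n]
  end.

Lemma cover_zeroS q F V (f : chom F V) n :
  cover_zero q.+1 f n <-> Hzero q.+1 (csub (cker f)) n.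
Proof. by []. Qed.

(* A map homotopic to the identity is an isomorphism on homology: here the
   identity of V is psi phi up to a map factoring through the projective Q. *)
Lemma cover_zero_retract q n : forall V V' Q (phi : chom V V') (psi : chom V' V)
    (al : chom V Q) (be : chom Q V) F (f : chom F V) F' (f' : chom F' V'),
  projective Q -> (forall i x, x = psi i (phi i x) + be i (al i x)) ->
  projective F -> chom_surj f -> projective F' -> chom_surj f' ->
  cover_zero q f' n -> cover_zero q f n.
Proof.
elim: q => [|q IHq] V V' Q phi psi al be F f F' f' pQ hom pF fs pF' fs' z'.
all: have [g gE] := pF _ _ f' (chom_comp phi f) fs'.
all: have [h hE] := pF' _ _ f (chom_comp psi f') fs.
all: have [b bE] := pQ _ _ f be fs.
all: have gK i x : x \in cker f i -> g i x \in cker f' i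
  by move=> /kerP fx; apply/kerP; rewrite gE /= fx chom_0.
all: have hK i x : x \in cker f' i -> h i x \in cker f i
  by move=> /kerP fx; apply/kerP; rewrite hE /= fx chom_0.
(* The composite of [f] with [c0] is (id - psi phi - be al) f = 0, so [c0] maps all of [F] into ker
   f. *)
all: pose c0 := chom_sub (chom_sub (chom_id F) (chom_comp h g))
  (chom_comp b (chom_comp al f)).
all: have cK i x : c0 i x \in cker f i
  by apply/kerP; rewrite /c0 /= !chom_B /= bE hE /= gE /= {1}[f i x]hom addrAC addrK subrr.
all: pose c := corestrict cK; pose gR := restrict gK; pose hR := restrict hK.
(* On ker f the term through [al] vanishes. So the identity of ker f factors through ker f' up to a
   map through the projective [F]: the hypothesis reproduces itself on the next syzygies. *)
all: have cE i (x : csub (cker f) i) : x = hR i (gR i x) + c i (sub_val x)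
  by apply: val_inj; rewrite /= ker_valP !chom_0 subr0 addrC subrK.
- move=> x xJ; rewrite [x]cE rpredD //; last exact: Jsub_map.
  by apply/Jsub_map/z'/(Jsub_map g).
have {z'} [G' [g' [pG' sg' z']]] := z'.
exists (free_cover (csub (cker f))), (cover_map _).
split; [exact: free_cover_projective|exact: cover_map_surj|].
apply: (IHq _ _ F gR hR (csub_incl (cker f)) c _ _ _ g') => //.
- exact: free_cover_projective.
- exact: cover_map_surj.
Qed.

Lemma chom0_linear V W i : linear (fun _ : V i => 0 : W i).
Proof. by move=> c x y; rewrite scaler0 addr0. Qed.
Lemma chom0_nat V W i j (a : FI i j) (x : V i) : 0 = cact W a 0.
Proof. by rewrite linear0. Qed.
Definition chom0 V W : chom V W := chom_of (@chom0_linear V W) (@chom0_nat V W).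

Lemma projective_eq0 V : (forall i (x : V i), x = 0) -> projective V.
Proof.
by move=> V0 A B p f _; exists (chom0 V A) => i x; rewrite [x]V0 !chom_0.
Qed.

(** Two projective modules onto the same [V] are compared through its identity, with zero correction
    term; vanishing can thus be tested on any of them. *)
Lemma Hzero_cover q V n F (f : chom F V) : projective F -> chom_surj f ->
  Hzero q.+1 V n -> cover_zero q f n.
Proof.
move=> pF fs [F' [f' [pF' fs' z']]].
apply: (@cover_zero_retract q n V V F' (chom_id V) (chom_id V)
  (chom0 V F') (chom0 F' V)) z' => // i x.
by rewrite /= addr0.
Qed.

Lemma HzeroSS q V n F (f : chom F V) : projective F -> chom_surj f ->
  Hzero q.+2 V n <-> Hzero q.+1 (csub (cker f)) n.
Proof.
move=> pF fs; split=> [|z]; first by move/(Hzero_cover pF fs).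
by exists F, f.
Qed.

(** * Short exact sequences and the horseshoe construction *)

Section ShortExact.
Variables (A B C : cmod k) (i : chom A B) (p : chom B C).
Record short_exact : Prop := ShortExact {
  se_inj : forall n x, i n x = 0 -> x = 0;
  se_surj : chom_surj p;
  se_comp : forall n x, p n (i n x) = 0;
  se_exact : forall n x, p n x = 0 -> exists y, x = i n y }.
End ShortExact.

Lemma Hzero0_extension A B C (i : chom A B) (p : chom B C) n :
  short_exact i p -> Hzero 0 A n -> Hzero 0 C n -> Hzero 0 B n.
Proof.
case=> inj surj comp exact zA zC b.
have [b' b'J pb'] := Jsub_lift surj (zC (p n b)).
have [|a ba] := exact n (b - b'); first by rewrite chom_B pb' subrr.
by rewrite -[b](subrK b') ba rpredD // Jsub_map.
Qed.

Section Horseshoe.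
Variables (A B C : cmod k) (i : chom A B) (p : chom B C).
Variables (FA FC : cmod k) (fA : chom FA A) (fC : chom FC C) (g : chom FC B).
Hypotheses (ex : short_exact i p) (fAs : chom_surj fA) (fCs : chom_surj fC).
Hypothesis gE : forall n x, p n (g n x) = fC n x.
Let fB : chom (dsum FA FC) B := copair (chom_comp i fA) g.

Lemma horseshoe_surj : chom_surj fB.
Proof.
move=> n b; have [y fy] := fCs (p n b).
have [|a ba] := se_exact ex (x := b - g n y); first by rewrite chom_B gE fy subrr.
have [x fx] := fAs a; exists (x, y).
by rewrite copairE /= fx -ba subrK.
Qed.

Lemma horseshoe_inlK n x : x \in cker fA n -> dsum_inl FA FC n x \in cker fB n.
Proof.
move=> /kerP fx; apply/kerP.
by rewrite [LHS]copairE /= fx !chom_0 addr0.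
Qed.
Lemma horseshoe_sndK n x : x \in cker fB n -> dsum_snd FA FC n x \in cker fC n.
Proof.
case: x => x y /kerP fxy; apply/kerP; rewrite -gE.
move: fxy => /(congr1 (p n)); rewrite chom_0 copairE.
by rewrite chom_D (se_comp ex) add0r.
Qed.
Definition horseshoe_inl := restrict horseshoe_inlK.
Definition horseshoe_snd := restrict horseshoe_sndK.

Lemma horseshoe_exact : short_exact horseshoe_inl horseshoe_snd.
Proof.
split=> [n x /(congr1 (@sub_val _ _ _)) /(congr1 fst) x0|n y|n x|n [[x y] xyK] y0].
- exact: val_inj.
- have gy : p n (g n (sub_val y)) = 0 by rewrite gE ker_valP.
  have [a ga] := se_exact ex gy; have [x fx] := fAs (- a).
  have xyK : ((x, sub_val y) : dsum FA FC n) \in cker fB n.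
    apply/kerP.
    by rewrite [LHS]copairE /= fx chom_N -ga addNr.
  by exists (SubLmod xyK); apply: val_inj.
- exact: val_inj.
have {}y0 : y = 0 by move: y0 => /(congr1 (@sub_val _ _ _)).
have fx : x \in cker fA n.
  apply/kerP/(se_inj ex); move: xyK => /kerP.
  by rewrite copairE y0 chom_0 addr0.
by exists (SubLmod fx); apply: val_inj; rewrite /= y0.
Qed.

Lemma horseshoe_H1_zero n : H1_zero fA n -> H1_zero fC n -> H1_zero fB n.
Proof.
move=> zA zC x xJ.
have yJ := zC (horseshoe_snd n x) (Jsub_map (dsum_snd FA FC) xJ).
have [x' x'J sx'] := Jsub_lift (se_surj horseshoe_exact) yJ.
have [|a ax] := se_exact horseshoe_exact (x := x - x').
  by rewrite chom_B sx' subrr.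
rewrite -[x](subrK x') rpredD // ax; apply/Jsub_map/zA.
(* The splitting of [dsum FA FC] enters here: the projection to [FA] recovers [a] and respects J. *)
rewrite [sub_val a](_ : _ = dsum_fst FA FC n (sub_val (x - x'))); last by rewrite ax.
apply: Jsub_map; rewrite -[sub_val _]/(csub_incl _ n (x - x')) chom_B rpredB //.
exact: Jsub_map.
Qed.
End Horseshoe.

(** The middle term of the long exact homology sequence, obtained without connecting maps: the
    horseshoe cover gives a short exact sequence of kernels, to which induction on [q] applies. *)
Lemma Hzero_extension q n : forall A B C (i : chom A B) (p : chom B C),
  short_exact i p -> Hzero q A n -> Hzero q C n -> Hzero q B n.
Proof.
have cover V : projective (free_cover V) /\ chom_surj (cover_map V).
  by split; [exact: free_cover_projective|exact: cover_map_surj].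
case: q => [|q]; first by move=> A B C i p ex; apply: (Hzero0_extension ex).
elim: q => [|q IHq] A B C i p ex zA zC.
all: have [[pA sA] [pC sC]] := (cover A, cover C).
all: have [g gE] := pC _ _ p (cover_map C) (se_surj ex).
all: have := horseshoe_surj ex sA sC gE.
all: exists (dsum (free_cover A) (free_cover C)),
  (copair (chom_comp i (cover_map A)) g).
all: split => //; first exact: dsum_projective.
  by apply: (horseshoe_H1_zero ex sA gE); [apply: Hzero_cover zA|apply: Hzero_cover zC].
apply/cover_zeroS/(IHq _ _ _ _ _ (horseshoe_exact ex sA gE)).
- by apply/(HzeroSS _ _ pA sA).
- by apply/(HzeroSS _ _ pC sC).
Qed.

(** The segment H_1(C) -> H_0(A) -> H_0(B) of the long exact sequence. A free cover F of B also
    covers C. A lift to JF of the image of [a] lies in the kernel K of F -> C, hence in JK, and F ->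
    B carries K into the image of A. *)
Lemma Hzero0_sub A B C (i : chom A B) (p : chom B C) n :
  short_exact i p -> Hzero 1 C n -> Hzero 0 B n -> Hzero 0 A n.
Proof.
move=> [inj surj comp exact] zC zB a.
pose F := free_cover B; pose f := cover_map B.
have fs : chom_surj f := @cover_map_surj k B.
have pF : projective F := @free_cover_projective k B.
have [x xJ fx] := Jsub_lift fs (zB (i n a)).
have pfs : chom_surj (chom_comp p f).
  by move=> m c; have [b <-] := surj m c; have [y <-] := fs m b; exists y.
have xK : x \in cker (chom_comp p f) n by apply/kerP; rewrite /= fx comp.
have {}zC := Hzero_cover pF pfs zC (SubLmod xK) xJ.
suff [a' a'J /eqP] : exists2 a', a' \in Jsub A n & i n a' = f n x.
  by rewrite fx -subr_eq0 -chom_B => /eqP/inj/subr0_eq <-.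
pose Q (z : csub (cker (chom_comp p f)) n) :=
  exists2 a', a' \in Jsub A n & i n a' = f n (sub_val z).
apply: (Jsub_ind (Q := Q)) zC => [|z y [b bJ iz] [c cJ iy]|m b z mn].
- by exists 0; rewrite ?rpred0 ?chom_0.
- by exists (b + c); rewrite ?rpredD // chom_D iz iy -chom_D.
have [c zc] := exact m (f m (sub_val z)) (ker_valP z).
by exists (cact A b c); rewrite ?J_genP // chom_nat -zc -chom_nat.
Qed.
End Morphisms.

(** * The derivative *)

Section Derivative.
Variable k : comPzRingType.
Implicit Types V W : cmod k.

Definition cshift V : cmod k :=
  @CMod k (fun n => V n.+1) (fun i j a => cact V (FI_ext a))
    (fun i x => etrans (congr1 (fun a => cact V a x) (FI_ext_id i)) (cact1 x))
    (fun i j l b a x =>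
       etrans (congr1 (fun c => cact V c x) (FI_ext_comp b a)) (cactM _ _ x)).

Lemma shift_incl_nat V i j (a : FI i j) (x : V i) :
  cact V (FI_shift j) (cact V a x) = cact (cshift V) a (cact V (FI_shift i) x).
Proof. by rewrite /= -!cactM FI_ext_shift. Qed.
Definition shift_incl V : chom V (cshift V) :=
  @CHom k V (cshift V) (fun n => cact V (FI_shift n)) (@shift_incl_nat V).

Definition cderiv V : cmod k := cquot (cim (shift_incl V)).

Definition cderiv_pi V n (x : V n.+1) : cderiv V n := qpi (cim (shift_incl V) n) x.

Lemma cderiv_ind V n (Q : cderiv V n -> Prop) :
  (forall x, Q (cderiv_pi x)) -> forall q, Q q.
Proof. exact: qpi_ind. Qed.

Lemma cderiv_pi_eq0 V n (x : V n.+1) :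
  cderiv_pi x = 0 <-> exists y, x = cact V (FI_shift n) y.
Proof. by rewrite qpi_eq0; split=> [/imP|?]; [|apply/imP]. Qed.

Lemma cderiv_pi_shift V n (y : V n) : cderiv_pi (cact V (FI_shift n) y) = 0.
Proof. by apply/cderiv_pi_eq0; exists y. Qed.

Lemma cderiv_piD V n (x y : V n.+1) : cderiv_pi (x + y) = cderiv_pi x + cderiv_pi y.
Proof. exact: qpiD. Qed.
Lemma cderiv_piB V n (x y : V n.+1) : cderiv_pi (x - y) = cderiv_pi x - cderiv_pi y.
Proof. exact: (linearB (qpi _)). Qed.

Lemma cderiv_act V i j (a : FI i j) (x : V i.+1) :
  cact (cderiv V) a (cderiv_pi x) = cderiv_pi (cact V (FI_ext a) x).
Proof. exact: qmapE. Qed.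

Section Map.
Variables (V W : cmod k) (f : chom V W).
Lemma cderiv_map_subproof n x :
  x \in cim (shift_incl V) n -> f n.+1 x \in cim (shift_incl W) n.
Proof. by move=> /imP[y ->]; apply/imP; exists (f n y); rewrite /= chom_nat. Qed.
Definition cderiv_app n : {linear cderiv V n -> cderiv W n} :=
  qmap (@cderiv_map_subproof n).
Lemma cderiv_appE n (x : V n.+1) : cderiv_app n (cderiv_pi x) = cderiv_pi (f n.+1 x).
Proof. exact: qmapE. Qed.
Lemma cderiv_map_nat i j (a : FI i j) q :
  cderiv_app j (cact (cderiv V) a q) = cact (cderiv W) a (cderiv_app i q).
Proof.
by elim/cderiv_ind: q => x; rewrite cderiv_act !cderiv_appE cderiv_act chom_nat.
Qed.
Definition cderiv_map : chom (cderiv V) (cderiv W) := CHom cderiv_map_nat.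
Lemma cderiv_mapE n (x : V n.+1) : cderiv_map n (cderiv_pi x) = cderiv_pi (f n.+1 x).
Proof. exact: cderiv_appE. Qed.

Lemma cderiv_map_surj : chom_surj f -> chom_surj cderiv_map.
Proof.
move=> fs n; elim/cderiv_ind => y; have [x <-] := fs n.+1 y.
by exists (cderiv_pi x); rewrite cderiv_mapE.
Qed.
End Map.

(* The right adjoint of [cderiv]. Its value at [n] is the product over the
   points x of [n] of the value of W at the complement of x. *)
Section Coinduction.
Variable W : cmod k.
Definition coind_obj n : lmodType k := {ffun 'I_n -> W n.-1}.
(** Injectivity of [a] leaves at most one term in the sum, and none outside the image of [a]. *)
Definition coind_act i j (a : FI i j) (w : coind_obj i) : coind_obj j :=
  [ffun y => \sum_(x | a x == y) cact W (FI_del a x) (w x)].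
Lemma coind_act_linear i j (a : FI i j) : linear (coind_act a).
Proof.
move=> c v w; apply/ffunP => y; rewrite !ffunE scaler_sumr -big_split /=.
by apply: eq_bigr => x _; rewrite !ffunE linearP.
Qed.
HB.instance Definition _ i j (a : FI i j) :=
  GRing.isLinear.Build k (coind_obj i) (coind_obj j) _ (coind_act a)
    (coind_act_linear a).
Lemma coind_actE i j (a : FI i j) (w : coind_obj i) x :
  coind_act a w (a x) = cact W (FI_del a x) (w x).
Proof.
by rewrite ffunE (big_pred1 x) // => z; rewrite (inj_eq (@FI_inj _ _ a)).
Qed.
Lemma coind_act_out i j (a : FI i j) (w : coind_obj i) y :
  (forall x, y != a x) -> coind_act a w y = 0.
Proof. by move=> ay; rewrite ffunE big1 // => x; rewrite eq_sym (negPf (ay x)). Qed.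
Lemma coind_act1 i (w : coind_obj i) : coind_act (FI_id i) w = w.
Proof.
apply/ffunP => x; rewrite ffunE (big_pred1 x) => [|z]; last by rewrite ffunE.
by rewrite FI_del_id cact1.
Qed.
Lemma coind_actM i j l (b : FI j l) (a : FI i j) (w : coind_obj i) :
  coind_act (FI_comp b a) w = coind_act b (coind_act a w).
Proof.
apply/ffunP => z; rewrite !ffunE.
rewrite (partition_big a (fun y => b y == z)) /=; last first.
  by move=> x; rewrite FI_compE.
apply: eq_bigr => y /eqP byz; rewrite ffunE linear_sum.
apply: eq_big => x; first by rewrite FI_compE; case: (a x =P y) => [->|_]; rewrite ?byz ?eqxx ?andbF.
by move=> /andP[_ /eqP <-]; rewrite FI_del_comp cactM.
Qed.
Definition coind : cmod k :=
  @CMod k coind_obj (fun i j a => coind_act a : {linear _ -> _})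
    coind_act1 coind_actM.
End Coinduction.

Section CoindMap.
Variables (V W : cmod k) (f : chom V W).
Lemma coind_map_linear n :
  linear (fun v : coind V n => [ffun x => f n.-1 (v x)] : coind W n).
Proof. by move=> c v w; apply/ffunP => x; rewrite !ffunE linearP. Qed.
Lemma coind_map_nat i j (a : FI i j) (v : coind V i) :
  [ffun x => f j.-1 (cact (coind V) a v x)] =
  cact (coind W) a ([ffun x => f i.-1 (v x)] : coind W i).
Proof.
apply/ffunP => y; rewrite !ffunE linear_sum; apply: eq_bigr => x _.
by rewrite !ffunE chom_nat.
Qed.
Definition coind_map : chom (coind V) (coind W) :=
  chom_of coind_map_linear coind_map_nat.
Lemma coind_mapE n (v : coind V n) x : coind_map n v x = f n.-1 (v x).
Proof. exact: ffunE. Qed.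

Lemma coind_map_surj : chom_surj f -> chom_surj coind_map.
Proof.
move=> fs n w; exists [ffun x => projT1 (cid (fs _ (w x)))].
by apply/ffunP => x; rewrite coind_mapE ffunE; case: cid.
Qed.
End CoindMap.

(** * The adjunction between the derivative and coinduction *)

Section Adjoint.
Variables (V W : cmod k).

Section ToCoind.
Variable f : chom (cderiv V) W.
Lemma to_coind_linear n : linear (fun v : V n =>
  [ffun x => f n.-1 (cderiv_pi (cact V (FI_front x) v))] : coind W n).
Proof.
move=> c v w; apply/ffunP => x; rewrite !ffunE -(linearP (f _)).
by congr (f _ _); rewrite /cderiv_pi -(linearP (qpi _)) linearP.
Qed.
Lemma to_coind_nat i j (a : FI i j) (v : V i) :
  [ffun y => f j.-1 (cderiv_pi (cact V (FI_front y) (cact V a v)))] =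
  cact (coind W) a
    ([ffun x => f i.-1 (cderiv_pi (cact V (FI_front x) v))] : coind W i).
Proof.
apply/ffunP => y; rewrite ffunE -cactM.
have [/existsP[x /eqP <-]|/existsPn ay] := boolP [exists x, a x == y].
  rewrite [RHS]coind_actE ffunE -chom_nat cderiv_act -cactM.
  by rewrite FI_front_comp.
have {}ay x : y != a x by rewrite eq_sym ay.
have [c ->] := FI_factor ay.
by rewrite [RHS]coind_act_out // cactM cderiv_pi_shift linear0.
Qed.
Definition to_coind : chom V (coind W) := chom_of to_coind_linear to_coind_nat.
Lemma to_coindE n (v : V n) x :
  to_coind n v x = f n.-1 (cderiv_pi (cact V (FI_front x) v)).
Proof. exact: ffunE. Qed.
End ToCoind.

Section OfCoind.
Variable g : chom V (coind W).
Definition of_coind_fun n (q : cderiv V n) : W n := g n.+1 (repr q) ord0.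
(** Independence of the representative: two of them differ by an element coming from [FI_shift],
    whose image misses [ord0], so the component at [ord0] is unchanged. *)
Lemma of_coindE n (v : V n.+1) : of_coind_fun (cderiv_pi v) = g n.+1 v ord0.
Proof.
apply/eqP; rewrite -subr_eq0 /of_coind_fun.
suff : g n.+1 (repr (cderiv_pi v) - v) ord0 = 0.
  by rewrite (linearB (g _)) !ffunE => ->.
have [y ->] : exists y, repr (cderiv_pi v) - v = cact V (FI_shift n) y.
  by apply/cderiv_pi_eq0; rewrite cderiv_piB {1}/cderiv_pi qpi_repr subrr.
rewrite chom_nat [LHS]coind_act_out // => x.
by rewrite [FI_shift n x](@FI_liftE n.+1) neq_lift.
Qed.
Lemma of_coind_linear n : linear (@of_coind_fun n).
Proof.
move=> c; elim/cderiv_ind => x; elim/cderiv_ind => y.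
rewrite /cderiv_pi -(linearP (qpi _)) -!/(cderiv_pi _) !of_coindE.
by rewrite (linearP (g _)) !ffunE.
Qed.
Lemma of_coind_nat i j (a : FI i j) (q : cderiv V i) :
  of_coind_fun (cact (cderiv V) a q) = cact W a (of_coind_fun q).
Proof.
elim/cderiv_ind: q => x; rewrite cderiv_act !of_coindE chom_nat.
have {1}<- : FI_ext a ord0 = ord0 by rewrite FI_consE.
by rewrite [LHS]coind_actE FI_del_ext.
Qed.
Definition of_coind : chom (cderiv V) W := chom_of of_coind_linear of_coind_nat.
End OfCoind.
End Adjoint.

(** A lifting problem out of [cderiv V] transposes to one out of [V], because [coind] is right
    adjoint to [cderiv] and preserves surjections. *)
Lemma cderiv_projective V : projective V -> projective (cderiv V).
Proof.
move=> pV A B p f psurj.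
have [g gE] := pV _ _ (coind_map p) (to_coind f) (coind_map_surj psurj).
exists (of_coind g) => i; elim/cderiv_ind => x.
rewrite [of_coind g i _]of_coindE.
have := congr1 (fun w : coind B i.+1 => w ord0) (gE i.+1 x).
by rewrite coind_mapE to_coindE FI_front0 cact1.
Qed.

(** An injection hitting [ord0] is, after moving the preimage to the front, an extension by the
    added point; one missing [ord0] factors through the shift and dies in the derivative.
    Conversely, the kernel of [cderiv_pi] consists of shifts, which lie in J. *)
Lemma Jsub_cderiv V n (x : V n.+1) :
  (x \in Jsub V n.+1) = (cderiv_pi x \in Jsub (cderiv V) n).
Proof.
apply/idP/idP.
  move: x; apply: Jsub_ind => [|x y xJ yJ|i a x ni].
  - by rewrite /cderiv_pi linear0 rpred0.
  - by rewrite cderiv_piD rpredD.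
  have [/existsP[z /eqP az]|/existsPn a0] := boolP [exists z, a z == ord0].
    have := FI_front_comp a z; rewrite az FI_front0 FI_comp1l => ->.
    rewrite cactM -cderiv_act J_genP //.
    by rewrite -ltnS prednK // (leq_ltn_trans (leq0n _) (ltn_ord z)).
  have {}a0 z : ord0 != a z by rewrite eq_sym a0.
  have [c] := FI_factor a0; rewrite FI_front0 FI_comp1l => ->.
  by rewrite cactM cderiv_pi_shift rpred0.
move=> xJ; pose Q (q : cderiv V n) := exists2 y, y \in Jsub V n.+1 & cderiv_pi y = q.
have [|y z [y' y'J <-] [z' z'J <-]|i a|y yJ yx] := Jsub_ind (Q := Q) _ _ _ xJ.
- by exists 0; rewrite ?rpred0 // /cderiv_pi linear0.
- by exists (y' + z'); rewrite ?rpredD // cderiv_piD.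
- elim/cderiv_ind => y ni; exists (cact V (FI_ext a) y); first exact: J_genP.
  by rewrite cderiv_act.
have [|u xyu] := (cderiv_pi_eq0 (x - y)).1; first by rewrite cderiv_piB yx subrr.
by rewrite -[x](subrK y) rpredD // xyu J_genP.
Qed.

Lemma Hzero0_cderiv V n : Hzero 0 V n.+1 <-> Hzero 0 (cderiv V) n.
Proof.
split=> z; first by elim/cderiv_ind => x; rewrite -Jsub_cderiv.
by move=> x; rewrite Jsub_cderiv.
Qed.
End Derivative.

(** * Degree bounds *)

Section Vanishing.
Variable k : comPzRingType.
Implicit Types V W : cmod k.

Definition torsion_free V : Prop :=
  forall n (x : V n), cact V (FI_shift n) x = 0 -> x = 0.

Definition zero_from e V : Prop := forall n (x : V n), (e <= n)%N -> x = 0.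

Lemma linv_inj V i j (a : FI i j) (x : V i) :
  (exists b, FI_comp b a = FI_id i) -> cact V a x = 0 -> x = 0.
Proof.
by move=> [b ba] ax; rewrite -[x](cact1) -ba cactM ax linear0.
Qed.

(** Up to a bijection, any injection that is not itself bijective ends in a standard inclusion,
    which can be cancelled; induction on [j] peels these off. *)
Lemma torsion_free_inj V i j (a : FI i j) (x : V i) :
  torsion_free V -> cact V a x = 0 -> x = 0.
Proof.
move=> tf; elim: j a => [|j IHj] a ax.
  exact: linv_inj (FI_linv a (leq0n i)) ax.
have [ij|ji] := ltnP i j.+1; last exact: linv_inj (FI_linv a ji) ax.
have [y ay] := FI_missing a ij; have [c ac] := FI_factor ay.
by apply: (IHj c); apply: tf; rewrite -cactM -ac cactM ax linear0.
Qed.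

(** After a bijection of the target, [a] also starts with the standard inclusion: a shift after [c]
    equals [FI_ext c] after a shift. *)
Lemma shift_kills V i j (a : FI i j) (x : V i) : (i < j)%N ->
  cact V (FI_shift i) x = 0 -> cact V a x = 0.
Proof.
move=> ij x0; have [y ay] := FI_missing a ij; have [c ac] := FI_factor ay.
apply: (linv_inj (FI_front_linv y)).
by rewrite -cactM ac -FI_ext_shift cactM x0 linear0.
Qed.

Lemma free_cover_torsion_free V : torsion_free (free_cover V).
Proof.
move=> n x x0; apply/val_inj/funext => -[i [h v]].
have := congr1 (fun y => sub_val y (fc_tag (FI_comp (FI_shift n) h) v)) x0.
rewrite /= /fc_act_fun /= (big_pred1 h) // => h'.
by apply/eqP/eqP => [/FI_comp_injl|->].
Qed.

Lemma projective_torsion_free F : projective F -> torsion_free F.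
Proof.
move=> pF n x x0.
have [s sE] := pF _ _ (cover_map F) (chom_id F) (@cover_map_surj k F).
have sx : s n x = 0 by apply: free_cover_torsion_free; rewrite -chom_nat x0 chom_0.
by have := sE n x; rewrite sx chom_0 => /esym.
Qed.

Lemma csub_torsion_free V (S : subcmod V) : torsion_free V -> torsion_free (csub S).
Proof.
by move=> tf n x /(congr1 (@sub_val _ _ _))/tf x0; apply: val_inj.
Qed.

Lemma short_exact_ker V W (f : chom V W) :
  chom_surj f -> short_exact (csub_incl (cker f)) f.
Proof.
move=> fs; split=> // [n x x0|n x|n x /kerP xK].
- exact: val_inj.
- exact: ker_valP.
- by exists (SubLmod xK).
Qed.

Lemma Hzero_eq0 p n V : (forall i (x : V i), x = 0) -> Hzero p V n.
Proof.
case: p => [|p]; first by move=> V0 x; rewrite [x]V0 rpred0.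
elim: p V => [|p IHp] V V0; exists V, (chom_id V).
all: split=> [|i x|]; [exact: projective_eq0|by exists x|].
  by move=> x _; rewrite (_ : x = 0) ?rpred0 //; apply: val_inj; rewrite [LHS]V0.
by apply/cover_zeroS/IHp => i x; apply: val_inj; rewrite [LHS]V0.
Qed.

(** Nakayama's lemma, by strong induction on the degree: elements of J come from strictly smaller
    degrees. *)
Lemma Hzero0_eq0 V : (forall n, Hzero 0 V n) -> forall n (x : V n), x = 0.
Proof.
move=> z n; elim/ltn_ind: n => n IHn x.
apply: (Jsub_ind (Q := fun y => y = 0)) (z n x) => //.
- by move=> y y' -> ->; rewrite addr0.
- by move=> i a y ni; rewrite (IHn i ni y) linear0.
Qed.

(** * The derivative of a kernel *)

Section DerivKer.
Variables (F V : cmod k) (f : chom F V).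
Lemma cderiv_ker_subproof i x :
  cderiv_map (csub_incl (cker f)) i x \in cker (cderiv_map f) i.
Proof.
apply/kerP; elim/cderiv_ind: x => x.
by rewrite !cderiv_mapE /= ker_valP /cderiv_pi linear0.
Qed.
(** The comparison D(ker f) -> ker(Df). As in the snake lemma, for surjective [f] it is onto, and
    its kernel is controlled by KV through the elements [f n y], with y as in [cderiv_ker_eq0]. *)
Definition cderiv_ker : chom (cderiv (csub (cker f))) (csub (cker (cderiv_map f))) :=
  corestrict cderiv_ker_subproof.

Lemma cderiv_kerE n (x : csub (cker f) n.+1) :
  sub_val (cderiv_ker n (cderiv_pi x)) = cderiv_pi (sub_val x).
Proof. by rewrite corestrictE cderiv_mapE. Qed.

Lemma cderiv_ker_surj : chom_surj f -> chom_surj cderiv_ker.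
Proof.
move=> fs n [q qK]; move: q qK; elim/cderiv_ind => w wK.
have /kerP := wK; rewrite cderiv_mapE => /cderiv_pi_eq0[v fw].
have [u fu] := fs n v.
(* Changing [w] by a shift leaves its class in the derivative unchanged and moves it into ker f. *)
have uK : w - cact F (FI_shift n) u \in cker f n.+1.
  by apply/kerP; rewrite chom_B chom_nat fu fw subrr.
exists (cderiv_pi (SubLmod uK : csub (cker f) n.+1)); apply: val_inj.
by rewrite [LHS]cderiv_kerE /= cderiv_piB cderiv_pi_shift subr0.
Qed.

Lemma cderiv_ker_eq0 n q : cderiv_ker n q = 0 ->
  exists (x : csub (cker f) n.+1) y,
    q = cderiv_pi x /\ sub_val x = cact F (FI_shift n) y.
Proof.
elim/cderiv_ind: q => x /(congr1 (@sub_val _ _ _)); rewrite cderiv_kerE.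
by move=> /cderiv_pi_eq0[y xy]; exists x, y.
Qed.

Lemma cderiv_pi_ker_shift n (x : csub (cker f) n.+1) y :
  sub_val x = cact F (FI_shift n) y -> f n y = 0 -> cderiv_pi x = 0.
Proof.
move=> xy /kerP yK; apply/cderiv_pi_eq0; exists (SubLmod yK); exact: val_inj.
Qed.

Lemma cderiv_ker_inj : torsion_free V -> forall n q, cderiv_ker n q = 0 -> q = 0.
Proof.
move=> tf n q /cderiv_ker_eq0[x [y [-> xy]]]; apply: (cderiv_pi_ker_shift xy).
by apply: tf; rewrite -chom_nat -xy ker_valP.
Qed.
End DerivKer.

(** DF is projective and maps onto DV; torsion-freeness of V makes D(ker f) isomorphic to ker(Df).
    Induction on [p] runs through these syzygies, ker f being torsion-free as a submodule of a
    projective. *)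
Lemma Hzero_cderiv p V n : torsion_free V ->
  Hzero p (cderiv V) n -> Hzero p V n.+1.
Proof.
case: p => [|p]; first by move=> _ /Hzero0_cderiv.
elim: p V => [|p IHp] V tf z.
all: set F := free_cover V; set f := cover_map V.
all: have pF : projective F := @free_cover_projective k V.
all: have fs : chom_surj f := @cover_map_surj k V.
all: have pDF := cderiv_projective pF; have Dfs := cderiv_map_surj fs.
  exists F, f; split=> // x xJ; rewrite Jsub_cderiv.
  have xJ' : cderiv_ker f n (cderiv_pi x) \in Jsub _ n.
    by apply: (Hzero_cover pDF Dfs z); rewrite cderiv_kerE -Jsub_cderiv.
  have [y yJ yx] := Jsub_lift (cderiv_ker_surj fs) xJ'.
  suff <- : y = cderiv_pi x by [].
  by apply/subr0_eq/(cderiv_ker_inj tf); rewrite chom_B yx subrr.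
apply/(HzeroSS _ _ pF fs)/IHp.
  exact/csub_torsion_free/projective_torsion_free.
(* The isomorphism is used as an extension of ker(Df) by a zero module. *)
apply: (Hzero_extension (short_exact_ker (cderiv_ker_surj fs))).
  apply: Hzero_eq0 => i x; apply: val_inj.
  exact/(cderiv_ker_inj tf)/ker_valP.
exact/(HzeroSS _ _ pDF Dfs).
Qed.

(** Outer induction on [p], inner on [e]: the derivative of V vanishes one degree earlier, while the
    correction term KV keeps the bound [e] but occurs in smaller homological degree. *)
Lemma Hzero_zero_from p e V n : zero_from e V -> (e + p <= n)%N -> Hzero p V n.
Proof.
elim: p e V n => [|p IHp] e V n.
  by rewrite addn0 => V0 en x; rewrite [x]V0 // rpred0.
elim: e V n => [|e IHe] V n V0 en; first by apply: Hzero_eq0 => i x; apply: V0.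
set F := free_cover V; set f := cover_map V.
have pF : projective F := @free_cover_projective k V.
have fs : chom_surj f := @cover_map_surj k V.
case: p => [|p] in IHp IHe en *.
  exists F, f; split=> // x xJ.
  suff [r rJ rx] : exists2 r : csub (cker f) n, r \in Jsub _ n & sub_val r = sub_val x.
    by rewrite -(val_inj rx).
  pose Q z := exists2 r : csub (cker f) n, r \in Jsub _ n & sub_val r = z.
  apply: (Jsub_ind (Q := Q)) xJ => [|_ _ [r rJ <-] [s sJ <-]|i a y ni].
  - by exists 0; rewrite ?rpred0.
  - by exists (r + s); rewrite ?rpredD.
  (* The map [a] factors through degree [n.-1], where V vanishes and ker f is therefore all of F. *)
  have [z az] := FI_missing a ni.
  have yK : cact F (FI_avoid az) y \in cker f n.-1.
    by apply/kerP/V0; case: (n) ni en => // m _; rewrite addn1.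
  exists (cact (csub (cker f)) (FI_lift z) (SubLmod yK)).
    by rewrite J_genP //; case: (n) ni.
  by rewrite -[in RHS](FI_avoidK az) cactM.
case: n en => [|n]; rewrite ?addnS // ltnS => en.
have pDF := cderiv_projective pF; have Dfs := cderiv_map_surj fs.
apply/(HzeroSS _ _ pF fs)/Hzero_cderiv.
  exact/csub_torsion_free/projective_torsion_free.
(* The kernel of [cderiv_ker] vanishes wherever V does and falls under [IHp]; its image ker(Df) is a
   syzygy of DV and falls under [IHe]. *)
apply: (Hzero_extension (short_exact_ker (cderiv_ker_surj fs))).
  apply: (IHp e.+1); last by rewrite addnS.
  move=> i x ei; apply: val_inj => /=.
  have [y [z [-> yz]]] := cderiv_ker_eq0 (ker_valP x).
  by apply: (cderiv_pi_ker_shift yz); apply: V0.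
apply/(HzeroSS _ _ pDF Dfs)/IHe; last by rewrite !addnS -addSn.
by move=> i; elim/cderiv_ind => x ei; rewrite [x]V0 // /cderiv_pi linear0.
Qed.

Lemma cquot_surj V (S : subcmod V) : chom_surj (cquot_pi S).
Proof. by move=> n; elim/qpi_ind => x; exists x. Qed.

Lemma cquot_pi_eq0 V (S : subcmod V) n (x : V n) : cquot_pi S n x = 0 <-> x \in S n.
Proof. exact: qpi_eq0. Qed.

Lemma Hzero0_surj V W (f : chom V W) n : chom_surj f -> Hzero 0 V n -> Hzero 0 W n.
Proof. by move=> fs z y; have [x <-] := fs n y; apply/Jsub_map/z. Qed.

Lemma cderiv_torsion V n (w : cderiv V n) : torsion_free V ->
  cact (cderiv V) (FI_shift n.+1) (cact (cderiv V) (FI_shift n) w) = 0 ->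
  cact (cderiv V) (FI_shift n) w = 0.
Proof.
elim/cderiv_ind: w => w tf; rewrite !cderiv_act => /cderiv_pi_eq0[u wu].
pose ss := FI_comp (FI_shift n.+1) (FI_shift n).
(* Call * the point added by the derivative. Once w lies in the image of a set
   avoiding *, the image of w in a larger set does not change when * is renamed
   to a new point. *)
have wE : cact V (FI_ext (FI_shift n.+2)) (cact V (FI_ext ss) w) =
    cact V (FI_shift n.+3) (cact V (FI_ext ss) w).
  by rewrite FI_ext_comp cactM wu -!cactM FI_ext_shift.
suff -> : cact V (FI_ext (FI_shift n)) w = cact V (FI_shift n.+1) w.
  exact: cderiv_pi_shift.
(* Pushing both sides forward along [FI_ext (FI_ext ss)] turns them into the two sides of [wE];
   torsion-freeness of V undoes the push. *)
apply/subr0_eq/(torsion_free_inj (a := FI_ext (FI_ext ss))) => //.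
rewrite linearB -!cactM -FI_ext_comp !FI_ext_shift FI_ext_comp !cactM wE.
by rewrite subrr.
Qed.

(** With homological degree p = [q.+1], the bound 2d - 1 + p becomes 2d + q, free of subtraction
    even at d = 0. *)
Lemma torsion_free_Hzero d q V n : torsion_free V ->
  (forall m, (d < m)%N -> Hzero 0 V m) -> (d.*2 + q < n)%N -> Hzero q.+1 V n.
Proof.
elim: d q V n => [|d IHd] q V [|n] // tf gen; rewrite ltnS => dn.
  (* If V is generated in degree 0, then H_0(DV) = 0, hence DV = 0. *)
  apply: Hzero_cderiv tf _; apply: Hzero_eq0; apply: Hzero0_eq0 => m.
  exact/Hzero0_cderiv/gen.
apply: (Hzero_cderiv tf).
pose S := cker (shift_incl (cderiv V)); pose p := cquot_pi S.
have ps : chom_surj p := @cquot_surj _ S.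
have genD m : (d < m)%N -> Hzero 0 (cderiv V) m.
  by move=> dm; apply/Hzero0_cderiv/gen.
(* DV/T, with T = [csub S], is torsion-free by [cderiv_torsion] and inherits the generation bound of
   DV. *)
have {}IHd r m : (d.*2 + r < m)%N -> Hzero r.+1 (cquot S) m.
  apply: IHd => {m} [m|m dm]; last exact/(Hzero0_surj ps)/genD.
  elim/qpi_ind => w; rewrite -[qpi _ w]/(p m w) -chom_nat.
  move=> /cquot_pi_eq0/kerP wS; apply/cquot_pi_eq0/kerP.
  exact: (cderiv_torsion tf wS).
have ex := short_exact_ker ps.
apply: (Hzero_extension ex); last first.
  by apply: IHd; rewrite doubleS in dn; lia.
(* T vanishes above degree 2d: there H_1(DV/T) and H_0(DV) are zero, hence so is H_0(T), which is T
   itself because every map to a larger set kills T. *)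
apply: (@Hzero_zero_from _ d.*2.+1); last by rewrite doubleS in dn; lia.
move=> m x dm.
have dm' : (d < m)%N by apply: leq_ltn_trans dm; rewrite -addnn leq_addr.
have z : Hzero 1 (cquot S) m by apply: IHd; rewrite addn0.
apply: (Jsub_ind (Q := fun y => y = 0)) (Hzero0_sub ex z (genD m dm') x) => //.
- by move=> y y' -> ->; rewrite addr0.
- move=> i a y im; apply: val_inj; apply: (shift_kills _ im).
  by have /cquot_pi_eq0/kerP := ker_valP y.
Qed.

(** * The torsion submodule *)

Section Torsion.
Variable V : cmod k.

(** Only standard inclusions are tested: up to a bijection, every injection is a composite of
    them. *)
Fixpoint killed m i (x : V i) : Prop :=
  if m is r.+1 then killed r (cact V (FI_shift i) x) else x = 0.

Lemma killed_act m i j (a : FI i j) (x : V i) : killed m x -> killed m (cact V a x).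
Proof.
elim: m i j a x => [|m IHm] i j a x /=; first by move=> ->; rewrite linear0.
by rewrite -cactM -FI_ext_shift cactM => /IHm.
Qed.

Lemma killed_add m r i (x y : V i) : killed m x -> killed r y -> killed (m + r) (x + y).
Proof.
elim: m i x y => [|m IHm] i x y /=; first by move=> ->; rewrite add0r.
by move=> xm yr; rewrite linearD; apply: IHm => //; apply: killed_act.
Qed.

Lemma killed_scale m i c (x : V i) : killed m x -> killed m (c *: x).
Proof.
elim: m i x => [|m IHm] i x /=; first by move=> ->; rewrite scaler0.
by rewrite linearZ_LR => /IHm.
Qed.

Definition tors_pred i : {pred V i} := [pred x | `[< exists m, killed m x >]].
Arguments tors_pred : clear implicits.
Lemma torsP i (x : V i) : reflect (exists m, killed m x) (x \in tors_pred i).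
Proof. exact: asboolP. Qed.
Lemma tors_closed i : subsemimod_closed (tors_pred i).
Proof.
split; first split=> [|x y /torsP[m xm] /torsP[r yr]].
- by apply/torsP; exists 0.
- by apply/torsP; exists (m + r)%N; apply: killed_add.
by move=> c x /torsP[m xm]; apply/torsP; exists m; apply: killed_scale.
Qed.
HB.instance Definition _ i :=
  GRing.isSubmodClosed.Build k (V i) (tors_pred i) (tors_closed i).
Lemma tors_act i j (a : FI i j) (x : V i) :
  x \in tors_pred i -> cact V a x \in tors_pred j.
Proof. by move=> /torsP[m xm]; apply/torsP; exists m; apply: killed_act. Qed.
Definition tors : subcmod V :=
  @SubCMod k V (fun i => tors_pred i : submodClosed _) tors_act.

Lemma cquot_tors_torsion_free : torsion_free (cquot tors).
Proof.
move=> n; elim/qpi_ind => x; rewrite -[qpi _ x]/(cquot_pi tors n x) -chom_nat.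
move=> /cquot_pi_eq0/torsP[m xm]; apply/cquot_pi_eq0/torsP.
by exists m.+1.
Qed.

Lemma tors_zero_from e :
  (forall n (x : V n), (e <= n)%N -> cact V (FI_shift n) x = 0 -> x = 0) ->
  forall n (x : V n), (e <= n)%N -> x \in tors n -> x = 0.
Proof.
move=> V0 n x en /torsP[m]; elim: m n x en => //= m IHm n x en.
by move=> /(IHm _ _ (leqW en))/V0; apply.
Qed.
End Torsion.

(** Here [e] is a strict bound on the torsion degree, so e + q stands for td + [q.+1]; e = 0 covers
    torsion-free modules. *)
Lemma Hzero_bound d e q V n :
  (forall m, (d < m)%N -> Hzero 0 V m) ->
  (forall m (x : V m), (e <= m)%N -> cact V (FI_shift m) x = 0 -> x = 0) ->
  (d.*2 + q < n)%N -> (e + q < n)%N -> Hzero q.+1 V n.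
Proof.
move=> gen V0 dn en; have ps := @cquot_surj _ (tors V).
apply: (Hzero_extension (short_exact_ker ps)).
  apply: (@Hzero_zero_from _ e); last by rewrite addnS.
  move=> m x em; apply: val_inj; apply: (tors_zero_from V0) em _.
  exact/cquot_pi_eq0/ker_valP.
apply: (torsion_free_Hzero _ _ dn); first exact: cquot_tors_torsion_free.
by move=> m dm; apply/(Hzero0_surj ps)/gen.
Qed.
End Vanishing.

(** * Comparison with the given resolution *)

Section Resolution.
Variable k : comPzRingType.

Section ShiftResolution.
Variables (V : cmod k) (P : proj_resolution V).
Lemma res_tail_subproof i (x : P 1 i) : res_d P 0 i x \in cker (res_aug P) i.
Proof. by apply/kerP/res_exact0; exists x. Qed.
Definition res_tail_aug : chom (P 1) (csub (cker (res_aug P))) :=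
  corestrict res_tail_subproof.
Lemma res_tail_surj : chom_surj res_tail_aug.
Proof.
move=> i x; have [y xy] := (res_exact0 _).1 (ker_valP x).
by exists y; apply: val_inj; rewrite [LHS]corestrictE.
Qed.
Lemma res_tail_exact0 i (x : P 1 i) :
  res_tail_aug i x = 0 <-> exists y, x = res_d P 1 i y.
Proof.
rewrite -res_exact; split=> [/(congr1 (@sub_val _ _ _)) //|dx].
exact: val_inj.
Qed.
(** The truncated resolution of the first syzygy: its [Hs] at [s.+1] is by definition that of [P] at
    [s.+2]. *)
Definition res_tail : proj_resolution (csub (cker (res_aug P))) :=
  @ProjResolution _ _ (fun n => P n.+1) (fun n => res_d P n.+1) res_tail_aug
    (fun n => @res_proj _ _ P n.+1) res_tail_surj res_tail_exact0
    (fun n => @res_exact _ _ P n.+1).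
End ShiftResolution.

Lemma homology_eq0 (U V W : cmod k) (f : chom U V) (g : chom V W) n :
  (forall x, g n x = 0 -> exists y, x = f n y) ->
  forall q : homology f g n, q = 0.
Proof.
move=> ex; elim/qpi_ind => x; apply/qpi_eq0/preimP/imP.
exact/ex/ker_valP.
Qed.

Lemma Hs_eq0 s (V : cmod k) (P : proj_resolution V) n :
  Hzero s.+1 V n -> forall x : Hs P s.+1 n, x = 0.
Proof.
elim: s V P => [|s IHs] V P z; last first.
  apply: (IHs _ (res_tail P)).
  exact/(HzeroSS _ _ (@res_proj _ _ P 0) (@res_surj _ _ P)).
have {}z := Hzero_cover (@res_proj _ _ P 0) (@res_surj _ _ P) z.
apply: homology_eq0; elim/qpi_ind => x.
rewrite [LHS]qmapE => /qpi_eq0 dxJ.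
(* A cycle [x] of H_0(P) is corrected by some [y] in J, which does not change its class, to a cycle
   of P itself; exactness then makes it a boundary. *)
have [y yJ xy] := Jsub_lift (@res_tail_surj _ P) (z (res_tail_aug P n x) dxJ).
have [|u xu] := (res_exact (p := P) (x - y)).1.
  have /(congr1 (@sub_val _ _ _)) : res_tail_aug P n (x - y) = 0.
    by rewrite chom_B xy subrr.
  by [].
exists (qpi _ u); rewrite [RHS]qmapE.
by apply/qpiE; rewrite -xu opprB addrC subrK.
Qed.

Section ConcMap.
Variables (V : cmod k) (i : nat) (v : V i).
Hypothesis v0 : cact V (FI_shift i) v = 0.
Lemma conc_map_linear j : linear (fun f : conc k i j =>
  \sum_g (f g : k) *: cact V (val g) v).
Proof.
move=> c f g; rewrite scaler_sumr -big_split; apply: eq_bigr => h _.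
by rewrite /= !ffunE scalerDl scalerA.
Qed.
Lemma conc_map_nat j l (a : FI j l) (f : conc k i j) :
  \sum_g (cact (conc k i) a f g : k) *: cact V (val g) v =
  cact V a (\sum_g (f g : k) *: cact V (val g) v).
Proof.
(* For j < l both sides are zero: the source lives in degree [i] only, and [v] is killed by every
   map to a larger set. Otherwise [a] is a bijection and the sum is reindexed. *)
have [jl|lj] := ltnP j l.
  rewrite linear_sum [RHS]big1 => [|g _]; last first.
    rewrite linearZ_LR -cactM shift_kills ?scaler0 //.
    by rewrite (eqP (valP g)).
  apply: big1 => g _; rewrite ffunE big1 ?scale0r // => h _.
  by exfalso; move: jl; rewrite -(eqP (valP h)) (eqP (valP g)) ltnn.
have jl : j = l by apply/eqP; rewrite eqn_leq (FI_leq a) lj.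
rewrite linear_sum.
have Pl (h : conc_basis i j) : i == l by rewrite -jl (valP h).
pose p (h : conc_basis i j) : conc_basis i l := exist _ (FI_comp a (val h)) (Pl h).
rewrite (partition_big p xpredT) //=; apply: eq_bigr => g _.
rewrite ffunE scaler_suml; apply: eq_big => [h|h /eqP ah]; first by [].
by rewrite linearZ_LR -cactM ah.
Qed.
Definition conc_map : chom (conc k i) V := chom_of conc_map_linear conc_map_nat.

Lemma conc_map_nonzero : v <> 0 -> chom_nonzero conc_map.
Proof.
move=> vn0; pose e : conc_basis i i := exist _ (FI_id i) (eqxx i).
pose f : conc k i i := [ffun g => (g == e)%:R].
exists i, f; rewrite (_ : conc_map i f = v) // [LHS](bigD1 e) //=.
rewrite ffunE eqxx scale1r cact1 big1 ?addr0 // => g /negPf ge.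
by rewrite ffunE ge scale0r.
Qed.
End ConcMap.

Lemma td_ge (V : cmod k) i (v : V i) :
  cact V (FI_shift i) v = 0 -> v <> 0 -> ((i%:Z)%:E <= td V)%E.
Proof.
move=> v0 vn0; apply: (td_leP V (td V)).1 => //.
by exists (conc_map v0); apply: conc_map_nonzero.
Qed.

(** Maps to larger sets act as zero on H_0(V), so every nonzero class there counts for its torsion
    degree. *)
Lemma gd_ge (V : cmod k) i : ~ Hzero 0 V i -> ((i%:Z)%:E <= gd V)%E.
Proof.
move=> /existsNP[x xJ]; apply: (@td_ge _ _ (cquot_pi (Jsub V) i x)).
  rewrite -chom_nat; apply/cquot_pi_eq0; exact: J_genP.
by move=> /cquot_pi_eq0.
Qed.

Lemma td_le (V : cmod k) (x : \bar int) :
  (forall i (v : V i), v <> 0 -> ((i%:Z)%:E <= x)%E) -> (td V <= x)%E.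
Proof.
move=> Vx; apply/td_leP => i [f [j [y fy]]].
suff ij : i == j by rewrite (eqP ij); apply: Vx fy.
apply: contra_notT fy => ij; rewrite [y](_ : _ = 0) ?linear0 //.
by apply/ffunP => g; have := valP g; rewrite (negPf ij).
Qed.
End Resolution.

(** * Assembly of the bounds in the extended integers *)

Unset Implicit Arguments.
Local Open Scope ereal_scope.

Theorem theorem1p9 (k : comPzRingType) (k_noeth : noetherian k)
    (V : cmod k) (V_fg : fin_gen V) (P : proj_resolution V)
    (s : nat) (s_ge1 : (1 <= s)%N) :
  hd P s <= maxe (2%:E * gd V - 1%:E) (td V) + (s%:Z)%:E.
Proof.
case: s s_ge1 => // q _; apply: td_le => i v vn0.
have {v vn0} nz : ~ Hzero q.+1 V i by move=> /(Hs_eq0 (P := P))/(_ v).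
have gen m : ~ (m%:Z)%:E <= gd V -> Hzero 0 V m.
  by apply: contra_notP; apply: gd_ge.
have tor m (x : V m) : ~ (m%:Z)%:E <= td V -> cact V (FI_shift m) x = 0%R -> x = 0%R.
  by move=> mV x0; apply: contra_notP mV; apply: td_ge.
(* A negative generating degree forces H_0(V) = 0, hence V = 0, against [nz]. *)
have pos : (0%:Z)%:E <= gd V.
  rewrite leNgt; apply/negP => g0; apply/nz/Hzero_eq0/Hzero0_eq0 => m.
  by apply: gen; apply/negP; rewrite -ltNge (lt_le_trans g0) // lee_fin.
rewrite leNgt; apply/negP => lti.
have maxl a b : a + (q.+1%:Z)%:E <= maxe a b + (q.+1%:Z)%:E :> \bar int.
  by rewrite leeD2r // le_max lexx.
have maxr a b : b + (q.+1%:Z)%:E <= maxe a b + (q.+1%:Z)%:E :> \bar int.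
  by rewrite leeD2r // le_max lexx orbT.
have ltg := le_lt_trans (maxl _ _) lti; have {lti} ltt := le_lt_trans (maxr _ _) lti.
(* Only a natural number [d] remains: [pos] excludes negative values, and +oo would make the bound
   in [ltg] infinite. *)
case: (gd V) gen pos ltg => [[d|//]| |] // gen _.
rewrite -EFinM -EFinB -EFinD lte_fin => di.
have {}gen m : (d < m)%N -> Hzero 0 V m.
  by move=> dm; apply: gen; apply/negP; rewrite lee_fin lez_nat -ltnNge.
have dqi : (d.*2 + q < i)%N by rewrite -muln2; lia.
case: (td V) tor ltt => [[t|t]| |] // tor; rewrite -?EFinD ?lte_fin => ti.
(* If td V is a natural number [t], the kernel of the shift vanishes from degree [t.+1] on; in the
   two cases below td V is negative or -oo, and it vanishes from degree 0. *)
- apply: nz; apply: (@Hzero_bound _ d t.+1) => //; last by lia.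
  move=> m x tm; apply: tor; apply/negP; rewrite lee_fin lez_nat -ltnNge.
  exact: tm.
- by apply: nz; apply: (@Hzero_bound _ d 0) => //; [move=> m x _; apply: tor|lia].
- by apply: nz; apply: (@Hzero_bound _ d 0) => //; [move=> m x _; apply: tor|lia].
Qed.
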